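(* Let $0 \le \alpha < 1$ and let $f = h + \overline{g} \in \mathcal{F}(\alpha)$ with $h(z) = z + \sum_{k=2}^\infty a_k z^k$ and $g(z) = \sum_{k=1}^\infty b_k z^k$. Then for all $n \ge 2$, $$|a_n| \le A_n(\alpha) \quad\text{and}\quad |b_n| \le \frac{n-1}{n-2\alpha}\,A_n(\alpha), \qquad\text{where } A_n(\alpha) = \frac{1}{n!}\prod_{j=2}^n (j - 2\alpha).$$ These bounds are sharp: equality holds in every inequality for the function $f_\alpha = h_\alpha + \overline{g_\alpha} \in \mathcal{F}(\alpha)$ given by $$f_\alpha(z) = \frac{1-(1-z)^{2\alpha-1}}{2\alpha-1} + \overline{\frac{1 - (1-z)^{2\alpha-1}(1 + z(2\alpha-1))}{2\alpha(2\alpha-1)}} \quad (\alpha \ne 0, 1/2),$$ $$f_0(z) = \frac{z}{1-z} + \overline{\frac{z}{1-z} + \log(1-z)}, \qquad f_{1/2}(z) = -\log(1-z) - \overline{\left(z + \log(1-z)\right)},$$ and for its rotations.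
   Context: $\mathbb{D} = \{z \in \mathbb{C} : |z| < 1\}$. For $\alpha \ge -1/2$, $\mathcal{F}(\alpha)$ denotes the set of complex-valued harmonic functions $f = h + \overline{g}$ on $\mathbb{D}$, with $h, g$ analytic in $\mathbb{D}$ normalized by $h(0) = g(0) = 0$, $h'(0) = 1$, such that $\operatorname{Re}\left(1 + \frac{z h''(z)}{h'(z)}\right) > \alpha$ for all $z \in \mathbb{D}$ and, for some real constant $\theta$, $g'(z) = e^{i\theta} z h'(z)$ for all $z \in \mathbb{D}$. Logarithms and powers of $1-z$ use the principal branch on $\mathbb{D}$. *)

(* Defs.v *)
From Stdlib Require Import Reals Lra Arith.
Open Scope R_scope.

Record Cx := mkC { re : R; im : R }.

Definition RtoC (x : R) : Cx := mkC x 0.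
Definition C0 : Cx := RtoC 0.
Definition C1 : Cx := RtoC 1.
Definition Cadd (z w : Cx) : Cx := mkC (re z + re w) (im z + im w).
Definition Copp (z : Cx) : Cx := mkC (- re z) (- im z).
Definition Csub (z w : Cx) : Cx := Cadd z (Copp w).
Definition Cmul (z w : Cx) : Cx :=
  mkC (re z * re w - im z * im w) (re z * im w + im z * re w).
Definition Cinv (z : Cx) : Cx :=
  mkC (re z / (re z ^ 2 + im z ^ 2)) (- im z / (re z ^ 2 + im z ^ 2)).
Definition Cdiv (z w : Cx) : Cx := Cmul z (Cinv w).
Definition Cnorm (z : Cx) : R := sqrt (re z ^ 2 + im z ^ 2).
Fixpoint Cpow (z : Cx) (n : nat) : Cx :=
  match n with O => C1 | S m => Cmul z (Cpow z m) end.

Definition Cexpi (t : R) : Cx := mkC (cos t) (sin t).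
Definition Cexp (z : Cx) : Cx := mkC (exp (re z) * cos (im z)) (exp (re z) * sin (im z)).

(* principal argument, in (-PI, PI] *)
Definition Carg (z : Cx) : R :=
  let x := re z in let y := im z in
  if Rlt_dec 0 x then atan (y / x)
  else if Rlt_dec x 0 then
         (if Rle_dec 0 y then atan (y / x) + PI else atan (y / x) - PI)
  else if Rlt_dec 0 y then PI / 2
  else if Rlt_dec y 0 then - (PI / 2) else 0.

Definition Clog (z : Cx) : Cx := mkC (ln (Cnorm z)) (Carg z).
(* principal power w^c (used only for w <> 0) *)
Definition Cpowc (w c : Cx) : Cx := Cexp (Cmul c (Clog w)).

Definition inD (z : Cx) : Prop := Cnorm z < 1.

Fixpoint Csum (u : nat -> Cx) (N : nat) : Cx :=
  match N with O => u O | S M => Cadd (Csum u M) (u (S M)) end.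

Definition has_sum (u : nat -> Cx) (s : Cx) : Prop :=
  Un_cv (fun N => re (Csum u N)) (re s) /\ Un_cv (fun N => im (Csum u N)) (im s).

Definition Cderiv_at (f : Cx -> Cx) (z l : Cx) : Prop :=
  forall eps, 0 < eps -> exists delta, 0 < delta /\
    forall w, 0 < Cnorm (Csub w z) < delta ->
      Cnorm (Csub (Cdiv (Csub (f w) (f z)) (Csub w z)) l) < eps.

Definition in_F (alpha : R) (h g : Cx -> Cx) : Prop :=
  exists (h1 h2 g1 : Cx -> Cx) (theta : R),
    h C0 = C0 /\ g C0 = C0 /\ h1 C0 = C1 /\
    forall z, inD z ->
      Cderiv_at h z (h1 z) /\ Cderiv_at h1 z (h2 z) /\ Cderiv_at g z (g1 z) /\
      h1 z <> C0 /\
      alpha < re (Cadd C1 (Cdiv (Cmul z (h2 z)) (h1 z))) /\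
      g1 z = Cmul (Cexpi theta) (Cmul z (h1 z)).

Fixpoint prodA (n : nat) (alpha : R) : R :=
  match n with
  | O => 1
  | S O => 1
  | S m => prodA m alpha * (INR (S m) - 2 * alpha)
  end.
Definition A (n : nat) (alpha : R) : R := prodA n alpha / INR (fact n).

Definition h_alpha (alpha : R) (z : Cx) : Cx :=
  if Req_EM_T alpha 0 then Cdiv z (Csub C1 z)
  else if Req_EM_T alpha (1/2) then Copp (Clog (Csub C1 z))
  else Cdiv (Csub C1 (Cpowc (Csub C1 z) (RtoC (2 * alpha - 1)))) (RtoC (2 * alpha - 1)).

Definition g_alpha (alpha : R) (z : Cx) : Cx :=
  if Req_EM_T alpha 0 then Cadd (Cdiv z (Csub C1 z)) (Clog (Csub C1 z))
  else if Req_EM_T alpha (1/2) then Copp (Cadd z (Clog (Csub C1 z)))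
  else Cdiv (Csub C1 (Cmul (Cpowc (Csub C1 z) (RtoC (2 * alpha - 1)))
                           (Cadd C1 (Cmul z (RtoC (2 * alpha - 1))))))
            (RtoC (2 * alpha * (2 * alpha - 1))).

Definition hrot (phi : R) (h : Cx -> Cx) (z : Cx) : Cx :=
  Cmul (Cexpi (- phi)) (h (Cmul (Cexpi phi) z)).
Definition grot (phi psi : R) (g : Cx -> Cx) (z : Cx) : Cx :=
  Cmul (Cexpi psi) (g (Cmul (Cexpi phi) z)).

(* Main.v *)
From Stdlib Require Import Reals Lra Lia Psatz.
From Coquelicot Require Import Rcomplements Hierarchy Continuity Derive RInt RInt_analysis
  Series ElemFct AutoDerive.
From Coquelicot Require Complex.
Require Import Defs.
Open Scope R_scope.

(** With [c_k] the coefficients of [h'] and [beta = 1 - alpha], the function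
    [P = 1 + z h'' / (beta h')] has positive real part and [P(0) = 1], so its
    coefficients satisfy Caratheodory's bound [|p_m| <= 2]. Comparing
    coefficients in [z h'' = beta (P - 1) h'] gives
    [n |c_n| <= 2 beta (|c_0| + ... + |c_{n-1}|)], and the numbers
    [(k+1) A_{k+1}] satisfy the same recursion with equality. The bounds on
    [b_n] follow from [n b_n = e^{i theta} (n-1) a_{n-1}]. For the extremal
    functions [(1 - z) h'' = (2 - 2 alpha) h'] determines the coefficients.

    To avoid Cauchy's theorem, [P] is never expanded: formal long division of
    the series of [z h'' + beta h'] by that of [beta h'] writes [P] as a
    polynomial plus [z^{m+1} Q] with [Q] a quotient of power series, and
    Caratheodory's bound follows from the mean value property of functions with
    a continuous complex derivative, applied on circles [|z| = r < 1]. *)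

(** * The field of complex numbers *)

(** Caratheodory's bound comes from averaging [re P] over [|w| = r] against the weight
    [1 + re (kappa w^n) / r^n], which is nonnegative when [|kappa| = 1]. The obstacle is the
    antiholomorphic half of the weight: [P conj(w)^n] is not holomorphic. On the circle, long
    division turns this product into the conjugate of a polynomial plus a holomorphic function. A
    conjugated polynomial has the same real part as the polynomial itself, so the weighted real part
    is the real part of one holomorphic function, whose value at 0 involves only [p_0] and [p_n].
    Letting [r] tend to 1 gives the bound.

    The mean value property needs no contour integrals: by the polar Cauchy-Riemann equations, the
    radial derivative of a circular mean is the integral of the derivative of a periodic function.
    The comparison of coefficients also goes through division: each remainder coefficient is a
    finite sum of products [p_i V_k], so no product of infinite series is formed. *)

Lemma Cx_eq (z w : Cx) : re z = re w -> im z = im w -> z = w.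
Proof. destruct z, w; simpl; congruence. Qed.

Lemma Cx_neq0 (z : Cx) : z <> C0 -> re z ^ 2 + im z ^ 2 <> 0.
Proof.
  intros H E; apply H, Cx_eq; simpl; nra.
Qed.

Lemma Cx_field : field_theory C0 C1 Cadd Cmul Csub Copp Cdiv Cinv (@eq Cx).
Proof.
  constructor.
  - constructor; intros; apply Cx_eq; simpl; ring.
  - intros E; apply (f_equal re) in E; simpl in E; lra.
  - reflexivity.
  - intros z Hz; apply Cx_neq0 in Hz.
    apply Cx_eq; unfold Cmul, Cinv, C1, RtoC; cbn [re im]; field; exact Hz.
Qed.

Add Field Cx_field_inst : Cx_field.

Definition Cconj (z : Cx) : Cx := mkC (re z) (- im z).

Lemma Cmul_neq0 (z w : Cx) : z <> C0 -> w <> C0 -> Cmul z w <> C0.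
Proof.
  intros Hz Hw E; apply Hw.
  replace w with (Cmul (Cinv z) (Cmul z w)) by (field; exact Hz).
  rewrite E; ring.
Qed.

Lemma RtoC_neq0 (x : R) : x <> 0 -> RtoC x <> C0.
Proof. intros H E; apply H; injection E; auto. Qed.

Lemma RtoC_add (x y : R) : RtoC (x + y) = Cadd (RtoC x) (RtoC y).
Proof. apply Cx_eq; simpl; ring. Qed.

Lemma RtoC_sub (x y : R) : RtoC (x - y) = Csub (RtoC x) (RtoC y).
Proof. apply Cx_eq; simpl; ring. Qed.

Lemma RtoC_mul (x y : R) : RtoC (x * y) = Cmul (RtoC x) (RtoC y).
Proof. apply Cx_eq; simpl; ring. Qed.

Lemma RtoC_S (n : nat) : RtoC (INR (S n)) = Cadd (RtoC (INR n)) C1.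
Proof. now rewrite S_INR, RtoC_add. Qed.

(** * Modulus *)

Lemma Cnorm_Cmod (z : Cx) : Cnorm z = Complex.Cmod (re z, im z).
Proof. reflexivity. Qed.

Lemma Cnorm_ge0 (z : Cx) : 0 <= Cnorm z.
Proof. apply sqrt_pos. Qed.

Lemma Cnorm_sqr (z : Cx) : Cnorm z ^ 2 = re z ^ 2 + im z ^ 2.
Proof. apply pow2_sqrt; nra. Qed.

Lemma Cnorm_mul (z w : Cx) : Cnorm (Cmul z w) = Cnorm z * Cnorm w.
Proof. rewrite !Cnorm_Cmod, <- Complex.Cmod_mult; reflexivity. Qed.

Lemma Cnorm_add (z w : Cx) : Cnorm (Cadd z w) <= Cnorm z + Cnorm w.
Proof. rewrite !Cnorm_Cmod; exact (Complex.Cmod_triangle (re z, im z) (re w, im w)). Qed.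

Lemma Cnorm_opp (z : Cx) : Cnorm (Copp z) = Cnorm z.
Proof. unfold Cnorm; simpl; f_equal; ring. Qed.

Lemma Cnorm_sub (z w : Cx) : Cnorm (Csub z w) <= Cnorm z + Cnorm w.
Proof. rewrite <- (Cnorm_opp w); apply Cnorm_add. Qed.

Lemma Cnorm_RtoC (x : R) : Cnorm (RtoC x) = Rabs x.
Proof.
  unfold Cnorm; simpl; replace (x * (x * 1) + 0 * (0 * 1)) with (Rsqr x) by (unfold Rsqr; ring).
  apply sqrt_Rsqr_abs.
Qed.

Lemma Cnorm_C0 : Cnorm C0 = 0.
Proof. unfold C0; rewrite Cnorm_RtoC; apply Rabs_R0. Qed.

Lemma Cnorm_C1 : Cnorm C1 = 1.
Proof. unfold C1; rewrite Cnorm_RtoC; apply Rabs_R1. Qed.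

Lemma Cnorm_eq0 (z : Cx) : Cnorm z = 0 -> z = C0.
Proof.
  intros H; pose proof (Cnorm_sqr z) as E; rewrite H in E.
  apply Cx_eq; simpl; nra.
Qed.

Lemma Cnorm_gt0 (z : Cx) : z <> C0 -> 0 < Cnorm z.
Proof.
  intros H; destruct (Cnorm_ge0 z) as [h|h]; auto.
  now elim H; apply Cnorm_eq0.
Qed.

Lemma Cnorm_neq0 (z : Cx) : 0 < Cnorm z -> z <> C0.
Proof. intros H ->; rewrite Cnorm_C0 in H; lra. Qed.

Lemma Cnorm_inv (z : Cx) : z <> C0 -> Cnorm (Cinv z) = / Cnorm z.
Proof.
  intros H; pose proof (Cnorm_gt0 z H).
  apply Rmult_eq_reg_l with (Cnorm z); [|lra].
  rewrite <- Cnorm_mul, Rinv_r by lra.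
  replace (Cmul z (Cinv z)) with C1 by (field; auto); apply Cnorm_C1.
Qed.

Lemma Cnorm_div (z w : Cx) : w <> C0 -> Cnorm (Cdiv z w) = Cnorm z / Cnorm w.
Proof. intros H; unfold Cdiv; now rewrite Cnorm_mul, Cnorm_inv. Qed.

Lemma Cnorm_pow (z : Cx) (n : nat) : Cnorm (Cpow z n) = Cnorm z ^ n.
Proof.
  induction n as [|n IH]; simpl; [apply Cnorm_C1|].
  now rewrite Cnorm_mul, IH.
Qed.

Lemma Cnorm_Cexpi (t : R) : Cnorm (Cexpi t) = 1.
Proof.
  unfold Cnorm, Cexpi; simpl.
  replace (cos t * (cos t * 1) + sin t * (sin t * 1)) with 1; [apply sqrt_1|].
  pose proof (sin2_cos2 t); unfold Rsqr in *; lra.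
Qed.

Lemma Cmul_conj (z : Cx) : Cmul z (Cconj z) = RtoC (Cnorm z ^ 2).
Proof. rewrite Cnorm_sqr; apply Cx_eq; simpl; ring. Qed.

Lemma Rabs_re_le (z : Cx) : Rabs (re z) <= Cnorm z.
Proof.
  rewrite <- sqrt_Rsqr_abs; apply sqrt_le_1_alt; unfold Rsqr; nra.
Qed.

Lemma Rabs_im_le (z : Cx) : Rabs (im z) <= Cnorm z.
Proof. rewrite <- sqrt_Rsqr_abs; apply sqrt_le_1_alt; unfold Rsqr; nra. Qed.

Lemma Cnorm_le_abs (z : Cx) : Cnorm z <= Rabs (re z) + Rabs (im z).
Proof.
  pose proof (Rabs_pos (re z)); pose proof (Rabs_pos (im z)).
  rewrite <- (sqrt_Rsqr (Rabs (re z) + Rabs (im z))) by lra.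
  apply sqrt_le_1_alt.
  rewrite <- (pow2_abs (re z)), <- (pow2_abs (im z)); unfold Rsqr; nra.
Qed.

Lemma inD_C0 : inD C0.
Proof. unfold inD; rewrite Cnorm_C0; lra. Qed.

(** * Continuity *)

(** Balls of the product structure make [Cx] a [UniformSpace], so that [continuous] and its
    composition lemmas apply; [continuous_Cnorm_lt] translates back to the modulus. *)
Definition Cx_ball (z : Cx) (e : R) (w : Cx) : Prop :=
  ball (re z) e (re w) /\ ball (im z) e (im w).

Lemma Cx_ball_center (z : Cx) (e : posreal) : Cx_ball z e z.
Proof. split; apply ball_center. Qed.

Lemma Cx_ball_sym (z w : Cx) (e : R) : Cx_ball z e w -> Cx_ball w e z.
Proof. intros [? ?]; split; apply ball_sym; auto. Qed.

Lemma Cx_ball_triangle (x y z : Cx) (e1 e2 : R) :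
  Cx_ball x e1 y -> Cx_ball y e2 z -> Cx_ball x (e1 + e2) z.
Proof. intros [? ?] [? ?]; split; eapply ball_triangle; eauto. Qed.

Definition Cx_UniformSpace_mixin :=
  UniformSpace.Mixin Cx C0 Cx_ball Cx_ball_center Cx_ball_sym Cx_ball_triangle.

Canonical Cx_UniformSpace := UniformSpace.Pack Cx Cx_UniformSpace_mixin Cx.

Section Continuity.

Context {U : UniformSpace}.

Lemma continuous_re (z : Cx) : continuous re z.
Proof.
  intros P [e He]; exists e; intros w [Hw _]; now apply He.
Qed.

Lemma continuous_im (z : Cx) : continuous im z.
Proof.
  intros P [e He]; exists e; intros w [_ Hw]; now apply He.
Qed.

Lemma continuous_mkC (f g : U -> R) (x : U) :
  continuous f x -> continuous g x -> continuous (fun y => mkC (f y) (g y)) x.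
Proof.
  intros Hf Hg P [e He].
  assert (H1 := Hf _ (locally_ball (f x) e)); assert (H2 := Hg _ (locally_ball (g x) e)).
  unfold filtermap in *.
  refine (filter_imp _ _ _ (filter_and _ _ H1 H2)); intros y [h1 h2].
  apply He; split; assumption.
Qed.

Lemma continuous_re_comp (f : U -> Cx) (x : U) :
  continuous f x -> continuous (fun y => re (f y)) x.
Proof. intros H; apply (continuous_comp f re x H), continuous_re. Qed.

Lemma continuous_im_comp (f : U -> Cx) (x : U) :
  continuous f x -> continuous (fun y => im (f y)) x.
Proof. intros H; apply (continuous_comp f im x H), continuous_im. Qed.

Lemma continuous_Rmult (f g : U -> R) (x : U) :
  continuous f x -> continuous g x -> continuous (fun y => f y * g y) x.
Proof. apply (continuous_mult (K := R_AbsRing)). Qed.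

Lemma continuous_Rplus (f g : U -> R) (x : U) :
  continuous f x -> continuous g x -> continuous (fun y => f y + g y) x.
Proof. apply (continuous_plus (V := R_NormedModule)). Qed.

Lemma continuous_Ropp (f : U -> R) (x : U) :
  continuous f x -> continuous (fun y => - f y) x.
Proof. apply (continuous_opp (V := R_NormedModule)). Qed.

Lemma continuous_Cadd (f g : U -> Cx) (x : U) :
  continuous f x -> continuous g x -> continuous (fun y => Cadd (f y) (g y)) x.
Proof.
  intros Hf Hg; apply continuous_mkC; apply continuous_Rplus;
    auto using continuous_re_comp, continuous_im_comp.
Qed.

Lemma continuous_Copp (f : U -> Cx) (x : U) :
  continuous f x -> continuous (fun y => Copp (f y)) x.
Proof.
  intros Hf; apply continuous_mkC; apply continuous_Ropp;
    auto using continuous_re_comp, continuous_im_comp.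
Qed.

Lemma continuous_Csub (f g : U -> Cx) (x : U) :
  continuous f x -> continuous g x -> continuous (fun y => Csub (f y) (g y)) x.
Proof. intros; apply continuous_Cadd; auto using continuous_Copp. Qed.

Lemma continuous_Cmul (f g : U -> Cx) (x : U) :
  continuous f x -> continuous g x -> continuous (fun y => Cmul (f y) (g y)) x.
Proof.
  intros Hf Hg; apply continuous_mkC; apply continuous_Rplus;
    try apply continuous_Ropp; apply continuous_Rmult;
    auto using continuous_re_comp, continuous_im_comp.
Qed.

Lemma continuous_Cinv (f : U -> Cx) (x : U) :
  f x <> C0 -> continuous f x -> continuous (fun y => Cinv (f y)) x.
Proof.
  intros H0 Hf.
  pose proof (continuous_re_comp f x Hf); pose proof (continuous_im_comp f x Hf).
  apply continuous_mkC; apply continuous_Rmult; auto using continuous_Ropp;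
    (apply (continuous_comp (fun y => re (f y) ^ 2 + im (f y) ^ 2) Rinv x);
     [|apply continuous_Rinv, Cx_neq0; auto]); simpl;
    apply continuous_Rplus; repeat (apply continuous_Rmult; auto);
    apply continuous_const.
Qed.

End Continuity.

(** Both directions compare the two metrics through [max(|re|, |im|) <= |.| <= |re| + |im|]; the
    halved radii pay for the second inequality. *)
Lemma continuous_Cnorm_lt (f : Cx -> Cx) (z : Cx) :
  continuous f z <-> forall eps, 0 < eps -> exists delta, 0 < delta /\
    forall w, Cnorm (Csub w z) < delta -> Cnorm (Csub (f w) (f z)) < eps.
Proof.
  split.
  - intros H eps He.
    assert (H2 : 0 < eps / 2) by lra.
    destruct (H _ (locally_ball (f z) (mkposreal _ H2))) as [d Hd].
    exists d; split; [apply cond_pos|]; intros w Hw.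
    assert (B : Cx_ball z d w).
    { split; (eapply Rle_lt_trans; [|exact Hw]); [apply (Rabs_re_le (Csub w z))|apply (Rabs_im_le (Csub w z))]. }
    destruct (Hd w B) as [B1 B2].
    eapply Rle_lt_trans; [apply Cnorm_le_abs|].
    change (Rabs (re (f w) - re (f z)) < eps / 2) in B1.
    change (Rabs (im (f w) - im (f z)) < eps / 2) in B2.
    change (Rabs (re (f w) - re (f z)) + Rabs (im (f w) - im (f z)) < eps); lra.
  - intros H P [e He].
    destruct (H e (cond_pos e)) as [d [Hd Hw]].
    assert (Hd2 : 0 < d / 2) by lra.
    exists (mkposreal _ Hd2); intros w [B1 B2]; apply He.
    change (Rabs (re w - re z) < d / 2) in B1; change (Rabs (im w - im z) < d / 2) in B2.
    assert (N : Cnorm (Csub w z) < d).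
    { eapply Rle_lt_trans; [apply Cnorm_le_abs|].
      change (Rabs (re w - re z) + Rabs (im w - im z) < d); lra. }
    specialize (Hw w N); split; (eapply Rle_lt_trans; [|exact Hw]);
      [apply (Rabs_re_le (Csub (f w) (f z)))|apply (Rabs_im_le (Csub (f w) (f z)))].
Qed.

(** * Complex derivatives *)

(* Caratheodory's form of differentiability reduces the rules of calculus to
   continuity of the slope. *)
Lemma Cderiv_at_slope (f : Cx -> Cx) (z l : Cx) :
  Cderiv_at f z l ->
  exists phi, continuous phi z /\ phi z = l /\
    forall w, Csub (f w) (f z) = Cmul (phi w) (Csub w z).
Proof.
  intros H.
  set (phi := fun w => if Req_EM_T (Cnorm (Csub w z)) 0 then l
                       else Cdiv (Csub (f w) (f z)) (Csub w z)).
  assert (Hz : phi z = l).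
  { unfold phi; destruct Req_EM_T as [|n]; auto; elim n.
    replace (Csub z z) with C0 by ring; apply Cnorm_C0. }
  exists phi; split; [|split]; auto.
  - apply continuous_Cnorm_lt; intros eps He; destruct (H eps He) as [d [Hd Hw]].
    exists d; split; auto; intros w Nw; rewrite Hz; unfold phi; destruct Req_EM_T as [E|n].
    + replace (Csub l l) with C0 by ring; now rewrite Cnorm_C0.
    + apply Hw; split; auto; pose proof (Cnorm_ge0 (Csub w z)); lra.
  - intros w; unfold phi; destruct Req_EM_T as [E|n].
    + apply Cnorm_eq0 in E; rewrite E.
      replace w with z; [ring|].
      replace w with (Cadd z (Csub w z)) by ring; rewrite E; ring.
    + field; intros E; apply n; rewrite E; apply Cnorm_C0.
Qed.

(** The factorization is asked only within distance [d] of [z], because for reciprocals it holds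
    only where the function does not vanish. *)
Lemma slope_Cderiv_at (f phi : Cx -> Cx) (z : Cx) (d : R) :
  0 < d -> continuous phi z ->
  (forall w, Cnorm (Csub w z) < d -> Csub (f w) (f z) = Cmul (phi w) (Csub w z)) ->
  Cderiv_at f z (phi z).
Proof.
  intros Hd Hc H eps He.
  destruct (proj1 (continuous_Cnorm_lt phi z) Hc eps He) as [d' [Hd' Hw]].
  exists (Rmin d d'); split; [now apply Rmin_glb_lt|]; intros w [N0 Nw].
  pose proof (Rmin_l d d'); pose proof (Rmin_r d d').
  rewrite H by lra.
  replace (Cdiv (Cmul (phi w) (Csub w z)) (Csub w z)) with (phi w)
    by (field; now apply Cnorm_neq0).
  apply Hw; lra.
Qed.

Lemma continuous_id_Cx (z : Cx) : continuous (fun w : Cx => w) z.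
Proof. apply continuous_id. Qed.

Lemma Cderiv_at_continuous (f : Cx -> Cx) (z l : Cx) :
  Cderiv_at f z l -> continuous f z.
Proof.
  intros H; destruct (Cderiv_at_slope f z l H) as [phi [Hc [_ Hs]]].
  apply (continuous_ext (fun w => Cadd (f z) (Cmul (phi w) (Csub w z)))).
  - intros w; change (Cadd (f z) (Cmul (phi w) (Csub w z)) = f w :> Cx); rewrite <- Hs; ring.
  - apply continuous_Cadd; [apply continuous_const|].
    apply continuous_Cmul; auto.
    apply continuous_Csub; [apply continuous_id_Cx|apply continuous_const].
Qed.

Lemma Cderiv_at_ext_loc (f g : Cx -> Cx) (z l : Cx) (d : R) :
  0 < d -> (forall w, Cnorm (Csub w z) < d -> f w = g w) ->
  Cderiv_at f z l -> Cderiv_at g z l.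
Proof.
  intros Hd E H; destruct (Cderiv_at_slope f z l H) as [phi [Hc [<- Hs]]].
  apply slope_Cderiv_at with d; auto; intros w Hw.
  rewrite <- Hs, !E; auto.
  replace (Csub z z) with C0 by ring; now rewrite Cnorm_C0.
Qed.

Lemma Cderiv_at_eq (f : Cx -> Cx) (z l l' : Cx) :
  Cderiv_at f z l -> l = l' -> Cderiv_at f z l'.
Proof. now intros H <-. Qed.

Lemma Cderiv_at_unique (f : Cx -> Cx) (z l l' : Cx) :
  Cderiv_at f z l -> Cderiv_at f z l' -> l = l'.
Proof.
  intros H H'.
  destruct (Req_dec (Cnorm (Csub l l')) 0) as [E|n].
  { apply Cnorm_eq0 in E; replace l with (Cadd (Csub l l') l') by ring; rewrite E; ring. }
  pose proof (Cnorm_ge0 (Csub l l')) as P.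
  assert (He : 0 < Cnorm (Csub l l') / 2) by lra.
  destruct (H _ He) as [d [Hd Hw]]; destruct (H' _ He) as [d' [Hd' Hw']].
  set (m := Rmin d d'); assert (Hm : 0 < m) by now apply Rmin_glb_lt.
  pose proof (Rmin_l d d'); pose proof (Rmin_r d d'); fold m in H0, H1.
  set (w := Cadd z (RtoC (m / 2))).
  assert (Nw : Cnorm (Csub w z) = m / 2).
  { replace (Csub w z) with (RtoC (m / 2)) by (unfold w; ring).
    rewrite Cnorm_RtoC; apply Rabs_pos_eq; lra. }
  specialize (Hw w); specialize (Hw' w); rewrite Nw in Hw, Hw'.
  specialize (Hw ltac:(lra)); specialize (Hw' ltac:(lra)).
  set (q := Cdiv (Csub (f w) (f z)) (Csub w z)) in *.
  pose proof (Cnorm_sub (Csub q l') (Csub q l)) as T.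
  replace (Csub (Csub q l') (Csub q l)) with (Csub l l') in T by ring; lra.
Qed.

Lemma Cderiv_at_const (c z : Cx) : Cderiv_at (fun _ => c) z C0.
Proof.
  apply (slope_Cderiv_at _ (fun _ => C0) z 1); [lra|apply continuous_const|].
  intros; ring.
Qed.

Lemma Cderiv_at_id (z : Cx) : Cderiv_at (fun w => w) z C1.
Proof.
  apply (slope_Cderiv_at _ (fun _ => C1) z 1); [lra|apply continuous_const|].
  intros; ring.
Qed.

Lemma Cderiv_at_add (f g : Cx -> Cx) (z l m : Cx) :
  Cderiv_at f z l -> Cderiv_at g z m ->
  Cderiv_at (fun w => Cadd (f w) (g w)) z (Cadd l m).
Proof.
  intros Hf Hg.
  destruct (Cderiv_at_slope _ _ _ Hf) as [p [Hp [<- Ep]]].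
  destruct (Cderiv_at_slope _ _ _ Hg) as [q [Hq [<- Eq]]].
  apply (slope_Cderiv_at _ (fun w => Cadd (p w) (q w)) z 1);
    [lra|now apply continuous_Cadd|].
  intros w _; transitivity (Cadd (Csub (f w) (f z)) (Csub (g w) (g z))); [ring|].
  rewrite Ep, Eq; ring.
Qed.

Lemma Cderiv_at_mul (f g : Cx -> Cx) (z l m : Cx) :
  Cderiv_at f z l -> Cderiv_at g z m ->
  Cderiv_at (fun w => Cmul (f w) (g w)) z (Cadd (Cmul l (g z)) (Cmul (f z) m)).
Proof.
  intros Hf Hg; pose proof (Cderiv_at_continuous _ _ _ Hg) as Cg.
  destruct (Cderiv_at_slope _ _ _ Hf) as [p [Hp [<- Ep]]].
  destruct (Cderiv_at_slope _ _ _ Hg) as [q [Hq [<- Eq]]].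
  apply (slope_Cderiv_at _ (fun w => Cadd (Cmul (p w) (g w)) (Cmul (f z) (q w))) z 1); [lra| |].
  - apply continuous_Cadd; apply continuous_Cmul; auto; apply continuous_const.
  - intros w _; transitivity (Cadd (Cmul (Csub (f w) (f z)) (g w)) (Cmul (f z) (Csub (g w) (g z))));
      [ring|rewrite Ep, Eq; ring].
Qed.

Lemma Cderiv_at_scal (c : Cx) (f : Cx -> Cx) (z l : Cx) :
  Cderiv_at f z l -> Cderiv_at (fun w => Cmul c (f w)) z (Cmul c l).
Proof.
  intros H; eapply Cderiv_at_eq; [apply Cderiv_at_mul; [apply Cderiv_at_const|exact H]|cbn beta; ring].
Qed.

Lemma Cderiv_at_opp (f : Cx -> Cx) (z l : Cx) :
  Cderiv_at f z l -> Cderiv_at (fun w => Copp (f w)) z (Copp l).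
Proof.
  intros H; apply (Cderiv_at_ext_loc (fun w => Cmul (Copp C1) (f w)) _ _ _ 1); [lra| |].
  - intros; ring.
  - eapply Cderiv_at_eq; [exact (Cderiv_at_scal _ f _ _ H)|ring].
Qed.

Lemma Cderiv_at_sub (f g : Cx -> Cx) (z l m : Cx) :
  Cderiv_at f z l -> Cderiv_at g z m ->
  Cderiv_at (fun w => Csub (f w) (g w)) z (Csub l m).
Proof. intros; apply Cderiv_at_add; auto using Cderiv_at_opp. Qed.

Lemma Cderiv_at_comp (f g : Cx -> Cx) (z l m : Cx) :
  Cderiv_at f (g z) l -> Cderiv_at g z m ->
  Cderiv_at (fun w => f (g w)) z (Cmul l m).
Proof.
  intros Hf Hg; pose proof (Cderiv_at_continuous _ _ _ Hg) as Cg.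
  destruct (Cderiv_at_slope _ _ _ Hf) as [p [Hp [<- Ep]]].
  destruct (Cderiv_at_slope _ _ _ Hg) as [q [Hq [<- Eq]]].
  apply (slope_Cderiv_at _ (fun w => Cmul (p (g w)) (q w)) z 1); [lra| |].
  - apply continuous_Cmul; auto; now apply (continuous_comp g p).
  - intros w _; rewrite Ep, Eq; ring.
Qed.

Lemma Cderiv_at_inv (f : Cx -> Cx) (z l : Cx) :
  f z <> C0 -> Cderiv_at f z l ->
  Cderiv_at (fun w => Cinv (f w)) z (Copp (Cdiv l (Cmul (f z) (f z)))).
Proof.
  intros H0 Hf; pose proof (Cderiv_at_continuous _ _ _ Hf) as Cf.
  destruct (Cderiv_at_slope _ _ _ Hf) as [p [Hp [<- Ep]]].
  (* A radius on which [|f w - f z| < |f z|], hence [f w] is nonzero. *)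
  destruct (proj1 (continuous_Cnorm_lt f z) Cf _ (Cnorm_gt0 _ H0)) as [d [Hd Hw]].
  apply (slope_Cderiv_at _ (fun w => Copp (Cmul (p w) (Cinv (Cmul (f w) (f z))))) z d); auto.
  - apply continuous_Copp, continuous_Cmul; auto.
    apply continuous_Cinv; [now apply Cmul_neq0|].
    apply continuous_Cmul; auto; apply continuous_const.
  - intros w Nw; assert (Hfw : f w <> C0).
    { intros E; specialize (Hw w Nw); rewrite E in Hw.
      replace (Csub C0 (f z)) with (Copp (f z)) in Hw by ring.
      rewrite Cnorm_opp in Hw; lra. }
    transitivity (Copp (Cmul (Csub (f w) (f z)) (Cinv (Cmul (f w) (f z)))));
      [field; auto|rewrite Ep; field; auto].
Qed.

Lemma Cderiv_at_div (f g : Cx -> Cx) (z l m : Cx) :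
  g z <> C0 -> Cderiv_at f z l -> Cderiv_at g z m ->
  Cderiv_at (fun w => Cdiv (f w) (g w)) z
    (Cdiv (Csub (Cmul l (g z)) (Cmul (f z) m)) (Cmul (g z) (g z))).
Proof.
  intros H0 Hf Hg.
  eapply Cderiv_at_eq; [exact (Cderiv_at_mul f (fun w => Cinv (g w)) z _ _ Hf (Cderiv_at_inv g z m H0 Hg))|].
  cbn beta; field; auto.
Qed.

(** The factor [c] is merely continuous, so the product rule does not apply; the second factor
    vanishes at [x], and that is enough. This carries the slope factorization over to real
    derivatives along curves. *)
Lemma is_derive_slope (c g : R -> R) (x l : R) :
  continuous c x -> is_derive g x l ->
  is_derive (fun t => c t * (g t - g x)) x (c x * l).
Proof.
  intros Hc Hg; apply is_derive_Reals in Hg; apply is_derive_Reals.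
  intros eps He.
  (* The three error terms below are at most [e], [e |l|] and [e |c x|], in total
     [e K <= eps / 2]. *)
  set (K := Rabs (c x) + Rabs l + 1).
  assert (HK : 0 < K) by (unfold K; pose proof (Rabs_pos (c x)); pose proof (Rabs_pos l); lra).
  set (e := Rmin 1 (eps / (2 * K))).
  assert (He' : 0 < e) by (apply Rmin_glb_lt; [lra|apply Rdiv_lt_0_compat; lra]).
  pose proof (Rmin_l 1 (eps / (2 * K))) as e1; pose proof (Rmin_r 1 (eps / (2 * K))) as e2.
  fold e in e1, e2.
  assert (e3 : e * K <= eps / 2).
  { apply Rmult_le_compat_r with (r := K) in e2; [|lra].
    replace (eps / (2 * K) * K) with (eps / 2) in e2 by (field; lra); lra. }
  destruct (Hg e He') as [d Hd].
  destruct (Hc _ (locally_ball (c x) (mkposreal e He'))) as [d' Hd'].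
  assert (Hm : 0 < Rmin d d') by (apply Rmin_glb_lt; apply cond_pos).
  exists (mkposreal _ Hm); intros h h0 hh; simpl in hh.
  pose proof (Rmin_l d d'); pose proof (Rmin_r d d').
  specialize (Hd h h0 ltac:(lra)).
  assert (B : ball x d' (x + h)) by (change (Rabs (x + h - x) < d'); replace (x + h - x) with h by ring; lra).
  specialize (Hd' _ B); change (Rabs (c (x + h) - c x) < e) in Hd'.
  set (q := (g (x + h) - g x) / h) in *.
  replace ((c (x + h) * (g (x + h) - g x) - c x * (g x - g x)) / h - c x * l)
    with ((c (x + h) - c x) * (q - l) + (c (x + h) - c x) * l + c x * (q - l))
    by (unfold q; field; auto).
  eapply Rle_lt_trans; [apply Rabs_triang|].
  eapply Rle_lt_trans; [apply Rplus_le_compat_r, Rabs_triang|].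
  rewrite !Rabs_mult.
  pose proof (Rabs_pos (c (x + h) - c x)); pose proof (Rabs_pos (q - l)).
  pose proof (Rabs_pos (c x)); pose proof (Rabs_pos l).
  assert (Rabs (c (x + h) - c x) * Rabs (q - l) <= e * 1) by (apply Rmult_le_compat; lra).
  assert (Rabs (c (x + h) - c x) * Rabs l <= e * Rabs l) by (apply Rmult_le_compat_r; lra).
  assert (Rabs (c x) * Rabs (q - l) <= Rabs (c x) * e) by (apply Rmult_le_compat_l; lra).
  unfold K in e3; lra.
Qed.

Lemma Cderiv_at_curve (f : Cx -> Cx) (x y : R -> R) (t dx dy : R) (l : Cx) :
  Cderiv_at f (mkC (x t) (y t)) l -> is_derive x t dx -> is_derive y t dy ->
  is_derive (fun s => re (f (mkC (x s) (y s)))) t (re (Cmul l (mkC dx dy))) /\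
  is_derive (fun s => im (f (mkC (x s) (y s)))) t (im (Cmul l (mkC dx dy))).
Proof.
  intros Hf Hx Hy.
  destruct (Cderiv_at_slope _ _ _ Hf) as [p [Hp [<- Ep]]].
  assert (Cxt : continuous x t) by (apply (ex_derive_continuous (V := R_NormedModule)); eexists; eauto).
  assert (Cyt : continuous y t) by (apply (ex_derive_continuous (V := R_NormedModule)); eexists; eauto).
  assert (Cc : continuous (fun s => mkC (x s) (y s)) t) by now apply continuous_mkC.
  assert (Cp : continuous (fun s => p (mkC (x s) (y s))) t)
    by now apply (continuous_comp (fun s => mkC (x s) (y s)) p).
  pose proof (continuous_re_comp _ _ Cp) as Cr; pose proof (continuous_im_comp _ _ Cp) as Ci.
  assert (E : forall s, f (mkC (x s) (y s)) =
    Cadd (f (mkC (x t) (y t))) (Cmul (p (mkC (x s) (y s))) (mkC (x s - x t) (y s - y t)))).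
  { intros s; specialize (Ep (mkC (x s) (y s))).
    change (mkC (x s - x t) (y s - y t)) with (Csub (mkC (x s) (y s)) (mkC (x t) (y t))).
    rewrite <- Ep; ring. }
  split.
  - apply (is_derive_ext (fun s => re (f (mkC (x t) (y t))) +
      (re (p (mkC (x s) (y s))) * (x s - x t) - im (p (mkC (x s) (y s))) * (y s - y t)))).
    { intros s; rewrite (E s); simpl; ring. }
    replace (re (Cmul (p (mkC (x t) (y t))) (mkC dx dy))) with (0 + (re (p (mkC (x t) (y t))) * dx - im (p (mkC (x t) (y t))) * dy))
      by (simpl; ring).
    apply (is_derive_plus (V := R_NormedModule)); [apply (is_derive_const (V := R_NormedModule))|].
    apply (is_derive_minus (V := R_NormedModule));
      [apply (is_derive_slope (fun s => re (p (mkC (x s) (y s)))))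
      |apply (is_derive_slope (fun s => im (p (mkC (x s) (y s)))))]; auto.
  - apply (is_derive_ext (fun s => im (f (mkC (x t) (y t))) +
      (re (p (mkC (x s) (y s))) * (y s - y t) + im (p (mkC (x s) (y s))) * (x s - x t)))).
    { intros s; rewrite (E s); simpl; ring. }
    replace (im (Cmul (p (mkC (x t) (y t))) (mkC dx dy))) with (0 + (re (p (mkC (x t) (y t))) * dy + im (p (mkC (x t) (y t))) * dx))
      by (simpl; ring).
    apply (is_derive_plus (V := R_NormedModule)); [apply (is_derive_const (V := R_NormedModule))|].
    apply (is_derive_plus (V := R_NormedModule));
      [apply (is_derive_slope (fun s => re (p (mkC (x s) (y s)))))
      |apply (is_derive_slope (fun s => im (p (mkC (x s) (y s)))))]; auto.
Qed.

(** Reduces complex differentiability to real calculus: derivatives along segments issued from [z],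
    of the form prescribed by [f1], plus continuity of [f1] at [z]. It serves for [Cexp] and [Clog],
    which are given by real and imaginary parts. *)
Lemma Cderiv_at_segments (f f1 : Cx -> Cx) (z : Cx) (d : R) :
  0 < d -> continuous f1 z ->
  (forall w t, Cnorm (Csub w z) < d -> 0 <= t <= 1 ->
     is_derive (fun s => re (f (Cadd z (Cmul (RtoC s) (Csub w z))))) t
       (re (Cmul (f1 (Cadd z (Cmul (RtoC t) (Csub w z)))) (Csub w z))) /\
     is_derive (fun s => im (f (Cadd z (Cmul (RtoC s) (Csub w z))))) t
       (im (Cmul (f1 (Cadd z (Cmul (RtoC t) (Csub w z)))) (Csub w z)))) ->
  Cderiv_at f z (f1 z).
Proof.
  intros Hd Hc H eps He.
  destruct (proj1 (continuous_Cnorm_lt f1 z) Hc (eps / 4) ltac:(lra)) as [d' [Hd' Hw]].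
  exists (Rmin d d'); split; [now apply Rmin_glb_lt|]; intros w [N0 Nw].
  pose proof (Rmin_l d d'); pose proof (Rmin_r d d').
  set (v := Csub w z) in *.
  set (seg := fun s => Cadd z (Cmul (RtoC s) v)).
  assert (Hv : v <> C0) by now apply Cnorm_neq0.
  assert (E1 : seg 1 = w) by (unfold seg, v; change (RtoC 1) with C1; ring).
  assert (E0 : seg 0 = z) by (unfold seg, v; change (RtoC 0) with C0; ring).
  assert (Near : forall t, 0 <= t <= 1 -> Cnorm (Cmul (Csub (f1 (seg t)) (f1 z)) v) <= eps / 4 * Cnorm v).
  { intros t Ht; rewrite Cnorm_mul; apply Rmult_le_compat_r; [lra|].
    apply Rlt_le, Hw; unfold seg.
    replace (Csub (Cadd z (Cmul (RtoC t) v)) z) with (Cmul (RtoC t) v) by ring.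
    rewrite Cnorm_mul, Cnorm_RtoC, Rabs_pos_eq by lra; nra. }
  (* The mean value theorem fails for complex-valued functions, so it is applied to each coordinate
     [P], with its own intermediate point. The two errors of [eps / 4] add up to less than [eps]. *)
  assert (Bnd : forall P : Cx -> R,
    (forall t, 0 <= t <= 1 -> is_derive (fun s => P (f (seg s))) t (P (Cmul (f1 (seg t)) v))) ->
    (forall a b, P (Csub a b) = P a - P b) -> (forall a, Rabs (P a) <= Cnorm a) ->
    Rabs (P (Csub (Csub (f w) (f z)) (Cmul (f1 z) v))) <= eps / 4 * Cnorm v).
  { intros P HP Psub Pn.
    destruct (MVT_gen (fun s => P (f (seg s))) 0 1 (fun t => P (Cmul (f1 (seg t)) v))) as [t [Ht Et]];
      rewrite ?Rmin_left, ?Rmax_right in * by lra.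
    - intros t Ht; apply HP; lra.
    - intros t Ht; apply continuity_pt_filterlim.
      apply (ex_derive_continuous (V := R_NormedModule)); eexists; now apply HP.
    - rewrite E1, E0 in Et.
      replace (P (Csub (Csub (f w) (f z)) (Cmul (f1 z) v)))
        with (P (Cmul (Csub (f1 (seg t)) (f1 z)) v)).
      + eapply Rle_trans; [apply Pn|now apply Near].
      + rewrite !Psub, Et.
        replace (Cmul (Csub (f1 (seg t)) (f1 z)) v) with (Csub (Cmul (f1 (seg t)) v) (Cmul (f1 z) v)) by ring.
        rewrite Psub; ring. }
  replace (Csub (Cdiv (Csub (f w) (f z)) v) (f1 z))
    with (Cdiv (Csub (Csub (f w) (f z)) (Cmul (f1 z) v)) v) by (field; auto).
  rewrite Cnorm_div by auto.
  apply Rmult_lt_reg_r with (Cnorm v); [lra|].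
  replace (Cnorm (Csub (Csub (f w) (f z)) (Cmul (f1 z) v)) / Cnorm v * Cnorm v)
    with (Cnorm (Csub (Csub (f w) (f z)) (Cmul (f1 z) v))) by (field; lra).
  eapply Rle_lt_trans; [apply Cnorm_le_abs|].
  pose proof (Bnd re) as B1; pose proof (Bnd im) as B2.
  apply Rle_lt_trans with (eps / 4 * Cnorm v + eps / 4 * Cnorm v); [|nra].
  apply Rplus_le_compat; [apply B1|apply B2]; auto using Rabs_re_le, Rabs_im_le;
    intros; apply H; auto; fold v; lra.
Qed.

(** * The mean value property *)

Definition hol_C1 (G : Cx -> Cx) : Prop :=
  exists G1, forall z, inD z -> Cderiv_at G z (G1 z) /\ continuous G1 z.

Lemma Cnorm_polar (s t : R) : Cnorm (mkC (s * cos t) (s * sin t)) = Rabs s.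
Proof.
  replace (mkC (s * cos t) (s * sin t)) with (Cmul (RtoC s) (Cexpi t))
    by (apply Cx_eq; simpl; ring).
  rewrite Cnorm_mul, Cnorm_Cexpi, Cnorm_RtoC; ring.
Qed.

Section MeanValue.

Variables G G1 : Cx -> Cx.
Hypothesis HG : forall z, inD z -> Cderiv_at G z (G1 z) /\ continuous G1 z.

Let polar (s t : R) : Cx := mkC (s * cos t) (s * sin t).

Lemma inD_polar (s t : R) : Rabs s < 1 -> inD (polar s t).
Proof. unfold inD, polar; now rewrite Cnorm_polar. Qed.

Lemma is_derive_radius (s t : R) : Rabs s < 1 ->
  is_derive (fun u => re (G (polar u t))) s (re (Cmul (G1 (polar s t)) (Cexpi t))).
Proof.
  intros Hs; apply (Cderiv_at_curve G (fun u => u * cos t) (fun u => u * sin t)).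
  - now apply HG, inD_polar.
  - auto_derive; auto; ring.
  - auto_derive; auto; ring.
Qed.

(** Polar Cauchy-Riemann equation: the tangent to the circle is [i s e^{it}], so [im G] varies with
    the angle [s] times as fast as [re G] varies with the radius. *)
Lemma is_derive_angle (s t : R) : 0 < s < 1 ->
  is_derive (fun u => / s * im (G (polar s u))) t (re (Cmul (G1 (polar s t)) (Cexpi t))).
Proof.
  intros Hs.
  replace (re (Cmul (G1 (polar s t)) (Cexpi t)))
    with (/ s * im (Cmul (G1 (polar s t)) (mkC (s * - sin t) (s * cos t))))
    by (simpl; field; lra).
  apply is_derive_scal.
  apply (Cderiv_at_curve G (fun u => s * cos u) (fun u => s * sin u)).
  - apply HG, inD_polar; rewrite Rabs_pos_eq; lra.
  - auto_derive; auto; ring.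
  - auto_derive; auto; ring.
Qed.

Lemma continuous_polar (p : R * R) : continuous (fun p => polar (fst p) (snd p)) p.
Proof.
  assert (Cos : continuous (fun q : R * R => cos (snd q)) p)
    by (apply (continuous_comp snd cos); [destruct p; apply continuous_snd|apply continuous_cos]).
  assert (Sin : continuous (fun q : R * R => sin (snd q)) p)
    by (apply (continuous_comp snd sin); [destruct p; apply continuous_snd|apply continuous_sin]).
  assert (Fst : continuous (fun q : R * R => fst q) p) by (destruct p; apply continuous_fst).
  apply continuous_mkC; now apply continuous_Rmult.
Qed.

Lemma continuous_radial_derive (s t : R) : Rabs s < 1 ->
  continuous (fun p : R * R => re (Cmul (G1 (polar (fst p) (snd p))) (Cexpi (snd p)))) (s, t).
Proof.
  intros Hs; apply continuous_re_comp, continuous_Cmul.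
  - apply (continuous_comp (fun p : R * R => polar (fst p) (snd p)) G1).
    + apply continuous_polar.
    + now apply HG, inD_polar.
  - apply continuous_mkC.
    + apply (continuous_comp snd cos); [apply continuous_snd|apply continuous_cos].
    + apply (continuous_comp snd sin); [apply continuous_snd|apply continuous_sin].
Qed.

Lemma continuous_pair_r (s t : R) : continuous (fun u : R => (s, u)) t.
Proof.
  intros P [e He]; exists e; intros y Hy; apply He; split; [apply ball_center|exact Hy].
Qed.

Lemma continuous_angle (s t : R) : Rabs s < 1 -> continuous (fun u => re (G (polar s u))) t.
Proof.
  intros Hs; apply continuous_re_comp.
  apply (continuous_comp (fun u => polar s u) G).
  - apply (continuous_comp (fun u : R => (s, u)) (fun p => polar (fst p) (snd p)));
      [apply continuous_pair_r|apply continuous_polar].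
  - eapply Cderiv_at_continuous, HG, inD_polar, Hs.
Qed.

Lemma locally_Rabs_lt1 (s : R) : Rabs s < 1 -> locally s (fun u => Rabs u < 1).
Proof.
  intros Hs; assert (H : 0 < 1 - Rabs s) by lra; exists (mkposreal _ H); intros u Hu.
  change (Rabs (u - s) < 1 - Rabs s) in Hu.
  replace u with ((u - s) + s) by ring; pose proof (Rabs_triang (u - s) s); lra.
Qed.

(** Differentiation under the integral sign. Radii range over [|s| < 1], not only over positive
    values, so that the mean is also known to be continuous at radius 0. *)
Lemma is_derive_mean (s : R) : Rabs s < 1 ->
  is_derive (fun u => RInt (fun t => re (G (polar u t))) 0 (2 * PI)) s
    (RInt (fun t => re (Cmul (G1 (polar s t)) (Cexpi t))) 0 (2 * PI)).
Proof.
  intros Hs.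
  rewrite (RInt_ext _ (fun t => Derive (fun u => re (G (polar u t))) s))
    by (intros t _; symmetry; now apply is_derive_unique, is_derive_radius).
  apply (is_derive_RInt_param (fun u t => re (G (polar u t)))).
  - refine (filter_imp _ _ _ (locally_Rabs_lt1 s Hs)); intros u Hu t _.
    eexists; now apply is_derive_radius.
  - intros t _; apply continuity_2d_pt_ext_loc
      with (f := fun u v => re (Cmul (G1 (polar u v)) (Cexpi v))).
    + assert (H : 0 < 1 - Rabs s) by lra; exists (mkposreal _ H); intros u v Hu _.
      symmetry; apply is_derive_unique, is_derive_radius; simpl in Hu.
      replace u with ((u - s) + s) by ring; pose proof (Rabs_triang (u - s) s); lra.
    + apply continuity_2d_pt_filterlim; now apply continuous_radial_derive.
  - refine (filter_imp _ _ _ (locally_Rabs_lt1 s Hs)); intros u Hu.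
    apply (ex_RInt_continuous (V := R_CompleteNormedModule)); intros t _; now apply continuous_angle.
Qed.

(** By [is_derive_angle] the integrand is the derivative of a function that takes the same value at
    [0] and [2 PI]. *)
Lemma mean_radial_derive (s : R) : 0 < s < 1 ->
  RInt (fun t => re (Cmul (G1 (polar s t)) (Cexpi t))) 0 (2 * PI) = 0.
Proof.
  intros Hs; apply is_RInt_unique.
  replace 0 with (minus (/ s * im (G (polar s (2 * PI)))) (/ s * im (G (polar s 0)))) at 2.
  - apply (is_RInt_derive (V := R_CompleteNormedModule) (fun u => / s * im (G (polar s u)))).
    + intros t _; now apply is_derive_angle.
    + intros t _.
      apply (continuous_comp (fun u : R => (s, u))
        (fun p => re (Cmul (G1 (polar (fst p) (snd p))) (Cexpi (snd p)))));
        [apply continuous_pair_r|apply continuous_radial_derive; rewrite Rabs_pos_eq; lra].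
  - unfold polar; rewrite cos_2PI, sin_2PI, cos_0, sin_0; apply Rminus_diag_eq; reflexivity.
Qed.

(** The mean has zero derivative in the radius and is continuous down to radius 0, where the circle
    degenerates to the centre. *)
Lemma circle_mean (r : R) : 0 < r < 1 ->
  RInt (fun t => re (G (polar r t))) 0 (2 * PI) = 2 * PI * re (G C0).
Proof.
  intros Hr.
  destruct (MVT_gen (fun u => RInt (fun t => re (G (polar u t))) 0 (2 * PI)) 0 r (fun _ => 0))
    as [c [_ Hc]]; rewrite ?Rmin_left, ?Rmax_right in * by lra.
  - intros s Hs.
    pose proof (is_derive_mean s) as D; rewrite (mean_radial_derive s) in D by lra.
    apply D; rewrite Rabs_pos_eq; lra.
  - intros s Hs; apply continuity_pt_filterlim.
    apply (ex_derive_continuous (V := R_NormedModule)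
             (fun u => RInt (fun t => re (G (polar u t))) 0 (2 * PI))).
    eexists; apply is_derive_mean; rewrite Rabs_pos_eq; lra.
  - assert (E : RInt (fun t => re (G (polar 0 t))) 0 (2 * PI) = (2 * PI - 0) * re (G C0)).
    { rewrite (RInt_ext (fun t => re (G (polar 0 t))) (fun _ => re (G C0))).
      - exact (RInt_const (V := R_CompleteNormedModule) 0 (2 * PI) (re (G C0))).
      - intros t _; do 2 f_equal; apply Cx_eq; simpl; ring. }
    lra.
Qed.

End MeanValue.

(** The form in which the mean value property enters Caratheodory's bound. *)
Lemma re_ge0_of_circle (G : Cx -> Cx) (r : R) :
  hol_C1 G -> 0 < r < 1 -> (forall z, Cnorm z = r -> 0 <= re (G z)) -> 0 <= re (G C0).
Proof.
  intros [G1 HG] Hr H; pose proof PI_RGT_0.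
  apply Rmult_le_reg_l with (2 * PI); [lra|]; rewrite Rmult_0_r.
  rewrite <- (circle_mean G G1 HG r Hr).
  apply RInt_ge_0; [lra| |].
  - apply (ex_RInt_continuous (V := R_CompleteNormedModule)); intros t _.
    apply (continuous_angle G G1 HG); rewrite Rabs_pos_eq; lra.
  - intros t _; apply H; rewrite Cnorm_polar; apply Rabs_pos_eq; lra.
Qed.

(** * Closure properties of functions with continuous complex derivative *)

Lemma hol_C1_deriv2 (f f1 f2 : Cx -> Cx) :
  (forall z, inD z -> Cderiv_at f z (f1 z)) ->
  (forall z, inD z -> Cderiv_at f1 z (f2 z)) -> hol_C1 f.
Proof.
  intros H1 H2; exists f1; intros z Hz; split; auto.
  eapply Cderiv_at_continuous; eauto.
Qed.

Lemma hol_C1_const (c : Cx) : hol_C1 (fun _ => c).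
Proof.
  exists (fun _ => C0); intros z _; split; [apply Cderiv_at_const|apply continuous_const].
Qed.

Lemma hol_C1_id : hol_C1 (fun z => z).
Proof.
  exists (fun _ => C1); intros z _; split; [apply Cderiv_at_id|apply continuous_const].
Qed.

Lemma hol_C1_add (f g : Cx -> Cx) :
  hol_C1 f -> hol_C1 g -> hol_C1 (fun z => Cadd (f z) (g z)).
Proof.
  intros [f1 Hf] [g1 Hg]; exists (fun z => Cadd (f1 z) (g1 z)); intros z Hz.
  destruct (Hf z Hz), (Hg z Hz); split; [now apply Cderiv_at_add|now apply continuous_Cadd].
Qed.

Lemma hol_C1_mul (f g : Cx -> Cx) :
  hol_C1 f -> hol_C1 g -> hol_C1 (fun z => Cmul (f z) (g z)).
Proof.
  intros [f1 Hf] [g1 Hg].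
  exists (fun z => Cadd (Cmul (f1 z) (g z)) (Cmul (f z) (g1 z))); intros z Hz.
  destruct (Hf z Hz) as [Df ?], (Hg z Hz) as [Dg ?]; split; [now apply Cderiv_at_mul|].
  apply Cderiv_at_continuous in Df, Dg.
  apply continuous_Cadd; now apply continuous_Cmul.
Qed.

Lemma hol_C1_inv (f : Cx -> Cx) :
  (forall z, inD z -> f z <> C0) -> hol_C1 f -> hol_C1 (fun z => Cinv (f z)).
Proof.
  intros H0 [f1 Hf].
  exists (fun z => Copp (Cdiv (f1 z) (Cmul (f z) (f z)))); intros z Hz.
  destruct (Hf z Hz) as [Df ?]; split; [apply Cderiv_at_inv; auto|].
  apply Cderiv_at_continuous in Df.
  apply continuous_Copp, continuous_Cmul; auto.
  apply continuous_Cinv; [apply Cmul_neq0; auto|now apply continuous_Cmul].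
Qed.

(** * Series of complex numbers *)

Lemma re_Csum (u : nat -> Cx) (N : nat) : re (Csum u N) = sum_f_R0 (fun k => re (u k)) N.
Proof. induction N as [|N IH]; simpl; [|rewrite IH]; reflexivity. Qed.

Lemma im_Csum (u : nat -> Cx) (N : nat) : im (Csum u N) = sum_f_R0 (fun k => im (u k)) N.
Proof. induction N as [|N IH]; simpl; [|rewrite IH]; reflexivity. Qed.

Lemma Csum_ext (u v : nat -> Cx) (N : nat) : (forall k, u k = v k) -> Csum u N = Csum v N.
Proof. intros E; induction N as [|N IH]; simpl; [|rewrite IH]; now rewrite E. Qed.

Lemma Csum_add (u v : nat -> Cx) (N : nat) :
  Csum (fun k => Cadd (u k) (v k)) N = Cadd (Csum u N) (Csum v N).
Proof. induction N as [|N IH]; simpl; [|rewrite IH]; ring. Qed.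

Lemma Csum_scal (c : Cx) (u : nat -> Cx) (N : nat) :
  Csum (fun k => Cmul c (u k)) N = Cmul c (Csum u N).
Proof. induction N as [|N IH]; simpl; [|rewrite IH]; ring. Qed.

Lemma Csum_recl (u : nat -> Cx) (N : nat) :
  Csum u (S N) = Cadd (u O) (Csum (fun k => u (S k)) N).
Proof.
  induction N as [|N IH]; [reflexivity|].
  change (Csum u (S (S N))) with (Cadd (Csum u (S N)) (u (S (S N)))).
  rewrite IH; simpl; ring.
Qed.

Lemma Un_cv_ext (u v : nat -> R) (l : R) : (forall n, u n = v n) -> Un_cv u l -> Un_cv v l.
Proof.
  intros E H eps He; destruct (H eps He) as [N HN]; exists N; intros n Hn.
  rewrite <- E; auto.
Qed.

Lemma Un_cv_const (c : R) : Un_cv (fun _ => c) c.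
Proof. intros eps He; exists O; intros; unfold Rdist; rewrite Rminus_diag, Rabs_R0; auto. Qed.

Lemma has_sum_ext (u v : nat -> Cx) (s : Cx) :
  (forall k, u k = v k) -> has_sum u s -> has_sum v s.
Proof.
  intros E [H1 H2]; split; [eapply Un_cv_ext, H1|eapply Un_cv_ext, H2];
    intros n; simpl; now rewrite (Csum_ext u v).
Qed.

Lemma has_sum_add (u v : nat -> Cx) (s t : Cx) :
  has_sum u s -> has_sum v t -> has_sum (fun k => Cadd (u k) (v k)) (Cadd s t).
Proof.
  intros [H1 H2] [H3 H4]; split.
  - eapply Un_cv_ext, (CV_plus _ _ _ _ H1 H3); intros n; now rewrite Csum_add.
  - eapply Un_cv_ext, (CV_plus _ _ _ _ H2 H4); intros n; now rewrite Csum_add.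
Qed.

Lemma has_sum_scal (c : Cx) (u : nat -> Cx) (s : Cx) :
  has_sum u s -> has_sum (fun k => Cmul c (u k)) (Cmul c s).
Proof.
  intros [H1 H2]; split.
  - eapply Un_cv_ext, (CV_minus _ _ _ _ (CV_mult _ _ _ _ (Un_cv_const (re c)) H1)
      (CV_mult _ _ _ _ (Un_cv_const (im c)) H2)).
    intros n; now rewrite Csum_scal.
  - eapply Un_cv_ext, (CV_plus _ _ _ _ (CV_mult _ _ _ _ (Un_cv_const (re c)) H2)
      (CV_mult _ _ _ _ (Un_cv_const (im c)) H1)).
    intros n; now rewrite Csum_scal.
Qed.

Lemma has_sum_shift (u : nat -> Cx) (s : Cx) :
  has_sum u s -> has_sum (fun k => u (S k)) (Csub s (u O)).
Proof.
  intros [H1 H2]; split.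
  - eapply Un_cv_ext, (CV_minus _ _ _ _ (CV_shift' _ 1%nat _ H1) (Un_cv_const (re (u O)))).
    intros n; cbv beta; rewrite Nat.add_1_r, Csum_recl; simpl; ring.
  - eapply Un_cv_ext, (CV_minus _ _ _ _ (CV_shift' _ 1%nat _ H2) (Un_cv_const (im (u O)))).
    intros n; cbv beta; rewrite Nat.add_1_r, Csum_recl; simpl; ring.
Qed.

Lemma has_sum_unshift (u : nat -> Cx) (s : Cx) :
  has_sum (fun k => u (S k)) s -> has_sum u (Cadd (u O) s).
Proof.
  intros [H1 H2]; split; apply CV_shift with 1%nat.
  - eapply Un_cv_ext, (CV_plus _ _ _ _ (Un_cv_const (re (u O))) H1).
    intros n; cbv beta; rewrite Nat.add_1_r, Csum_recl; reflexivity.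
  - eapply Un_cv_ext, (CV_plus _ _ _ _ (Un_cv_const (im (u O))) H2).
    intros n; cbv beta; rewrite Nat.add_1_r, Csum_recl; reflexivity.
Qed.

Lemma has_sum_unique (u : nat -> Cx) (s t : Cx) : has_sum u s -> has_sum u t -> s = t.
Proof.
  intros [H1 H2] [H3 H4]; apply Cx_eq; eapply UL_sequence; eauto.
Qed.

Lemma has_sum_norm_le (u : nat -> Cx) (s : Cx) (K : R) :
  has_sum u s -> (forall N, Cnorm (Csum u N) <= K) -> Cnorm s <= K.
Proof.
  intros [H1 H2] HK; apply le_epsilon; intros e He.
  destruct (H1 (e / 2) ltac:(lra)) as [N1 h1]; destruct (H2 (e / 2) ltac:(lra)) as [N2 h2].
  specialize (h1 (Nat.max N1 N2) ltac:(lia)); specialize (h2 (Nat.max N1 N2) ltac:(lia)).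
  set (S := Csum u (Nat.max N1 N2)) in *.
  replace s with (Csub S (Csub S s)) by ring.
  eapply Rle_trans; [apply Cnorm_sub|]; apply Rplus_le_compat; [apply HK|].
  eapply Rle_trans; [apply Cnorm_le_abs|].
  unfold Rdist in *; change (Rabs (re S - re s) + Rabs (im S - im s) <= e); lra.
Qed.

Lemma has_sum_terms_bounded (u : nat -> Cx) (s : Cx) :
  has_sum u s -> exists M, 0 < M /\ forall k, Cnorm (u k) <= M.
Proof.
  intros [H1 H2].
  destruct (maj_by_pos _ (exist _ _ H1)) as [M1 [P1 B1]].
  destruct (maj_by_pos _ (exist _ _ H2)) as [M2 [P2 B2]].
  exists (2 * (M1 + M2)); split; [lra|].
  assert (B : forall k, Cnorm (Csum u k) <= M1 + M2).
  { intros k; eapply Rle_trans; [apply Cnorm_le_abs|]; specialize (B1 k); specialize (B2 k); lra. }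
  intros [|k]; [specialize (B O); simpl in B; lra|].
  replace (u (S k)) with (Csub (Csum u (S k)) (Csum u k)) by (simpl; ring).
  eapply Rle_trans; [apply Cnorm_sub|]; pose proof (B k); pose proof (B (S k)); lra.
Qed.

Definition Cseries (u : nat -> Cx) : Cx :=
  mkC (Series (fun k => re (u k))) (Series (fun k => im (u k))).

Lemma has_sum_geom_bound (u : nat -> Cx) (M s : R) :
  0 < s < 1 -> (forall k, Cnorm (u k) <= M * s ^ k) -> has_sum u (Cseries u).
Proof.
  intros Hs H.
  assert (G : ex_series (fun k => M * s ^ k)).
  { apply (ex_series_scal (V := R_NormedModule)), ex_series_geom; rewrite Rabs_pos_eq; lra. }
  assert (X : forall v : nat -> R, (forall k, Rabs (v k) <= Cnorm (u k)) ->
    Un_cv (fun N => sum_f_R0 v N) (Series v)).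
  { intros v Hv; apply is_series_Reals, Series_correct.
    apply (ex_series_le (V := R_CompleteNormedModule)) with (2 := G); intros k.
    eapply Rle_trans; [apply Hv|apply H]. }
  split; simpl.
  - eapply Un_cv_ext, X; [intros N; symmetry; apply re_Csum|intros; apply Rabs_re_le].
  - eapply Un_cv_ext, X; [intros N; symmetry; apply im_Csum|intros; apply Rabs_im_le].
Qed.

Lemma Csum_geom_bound (u : nat -> Cx) (M s : R) (N : nat) :
  0 <= M -> 0 < s < 1 -> (forall k, Cnorm (u k) <= M * s ^ k) ->
  Cnorm (Csum u N) <= M / (1 - s).
Proof.
  intros HM Hs H.
  assert (B : Cnorm (Csum u N) <= M / (1 - s) * (1 - s ^ S N)).
  { induction N as [|N IH].
    - simpl Csum; eapply Rle_trans; [apply H|]; right; simpl; field; lra.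
    - simpl Csum; eapply Rle_trans; [apply Cnorm_add|].
      eapply Rle_trans; [apply Rplus_le_compat; [exact IH|apply H]|].
      right; simpl; field; lra. }
  eapply Rle_trans; [exact B|].
  assert (0 <= M / (1 - s)) by (apply Rdiv_le_0_compat; lra).
  pose proof (pow_le s (S N) ltac:(lra)); nra.
Qed.

(** * Power series on the unit disc *)

(** Convergence at every point of the disc replaces a radius of convergence; unfolded, this is
    literally the hypothesis on [h] and [g] in the theorem. *)
Definition PS (a : nat -> Cx) (f : Cx -> Cx) : Prop :=
  forall z, inD z -> has_sum (fun k => Cmul (a k) (Cpow z k)) (f z).

Lemma PS_ext (a b : nat -> Cx) (f g : Cx -> Cx) :
  (forall k, a k = b k) -> (forall z, inD z -> f z = g z) -> PS a f -> PS b g.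
Proof.
  intros E Ef H z Hz; rewrite <- Ef by auto.
  apply has_sum_ext with (2 := H z Hz); intros k; now rewrite E.
Qed.

Lemma PS_add (a b : nat -> Cx) (f g : Cx -> Cx) :
  PS a f -> PS b g -> PS (fun k => Cadd (a k) (b k)) (fun z => Cadd (f z) (g z)).
Proof.
  intros Ha Hb z Hz; eapply has_sum_ext, (has_sum_add _ _ _ _ (Ha z Hz) (Hb z Hz)).
  intros; simpl; ring.
Qed.

Lemma PS_scal (c : Cx) (a : nat -> Cx) (f : Cx -> Cx) :
  PS a f -> PS (fun k => Cmul c (a k)) (fun z => Cmul c (f z)).
Proof.
  intros Ha z Hz; eapply has_sum_ext, (has_sum_scal c _ _ (Ha z Hz)).
  intros; simpl; ring.
Qed.

Lemma PS_mulX (a : nat -> Cx) (f : Cx -> Cx) :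
  PS a f -> PS (fun k => match k with O => C0 | S j => a j end) (fun z => Cmul z (f z)).
Proof.
  intros Ha z Hz.
  replace (Cmul z (f z)) with (Cadd (Cmul C0 (Cpow z 0)) (Cmul z (f z))) by ring.
  apply (has_sum_unshift (fun k => Cmul match k with O => C0 | S j => a j end (Cpow z k))).
  eapply has_sum_ext, (has_sum_scal z _ _ (Ha z Hz)).
  intros; simpl; ring.
Qed.

Lemma PS_C0 (a : nat -> Cx) (f : Cx -> Cx) : PS a f -> f C0 = a O.
Proof.
  intros H; apply (has_sum_unique _ _ _ (H C0 inD_C0)).
  assert (E : forall N, Csum (fun k => Cmul (a k) (Cpow C0 k)) N = a O).
  { induction N as [|N IH]; simpl; [|rewrite IH]; ring. }
  split; eapply Un_cv_ext; try apply Un_cv_const; intros n; simpl; now rewrite E.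
Qed.

Lemma PS_shift (a : nat -> Cx) (f : Cx -> Cx) :
  PS a f -> exists g, PS (fun k => a (S k)) g /\
    forall z, inD z -> f z = Cadd (a O) (Cmul z (g z)).
Proof.
  intros H.
  (* The value [a 1] fills the removable singularity of [(f z - a 0) / z] at 0. *)
  exists (fun z => if Req_EM_T (Cnorm z) 0 then a 1%nat else Cdiv (Csub (f z) (a O)) z).
  split; intros z Hz; destruct Req_EM_T as [E|n].
  - apply Cnorm_eq0 in E; subst z.
    assert (E : forall N, Csum (fun k => Cmul (a (S k)) (Cpow C0 k)) N = a 1%nat).
    { induction N as [|N IH]; simpl; [|rewrite IH]; ring. }
    split; eapply Un_cv_ext; try apply Un_cv_const; intros N; simpl; now rewrite E.
  - assert (z0 : z <> C0) by (intros ->; apply n, Cnorm_C0).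
    eapply has_sum_ext with (u := fun k => Cmul (Cinv z) (Cmul (a (S k)) (Cpow z (S k)))).
    { intros k; simpl; field; auto. }
    replace (Cdiv (Csub (f z) (a O)) z)
      with (Cmul (Cinv z) (Csub (f z) (Cmul (a O) (Cpow z O)))) by (simpl; field; auto).
    apply has_sum_scal, (has_sum_shift (fun k => Cmul (a k) (Cpow z k))), H, Hz.
  - apply Cnorm_eq0 in E; subst z; rewrite (PS_C0 a f H); ring.
  - field; intros ->; apply n, Cnorm_C0.
Qed.

(** [k s^k] is at most [1 + s + ... + s^(k-1)], since every term is at least [s^k]; the induction
    keeps the exact value [(1 - s^k) / (1 - s)] of that sum. *)
Lemma INR_pow_le (s : R) (k : nat) : 0 < s < 1 -> INR k * s ^ k <= / (1 - s).
Proof.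
  intros Hs.
  assert (B : (1 - s) * (INR k * s ^ k) <= 1 - s ^ k).
  { induction k as [|k IH]; [simpl; lra|].
    rewrite S_INR; simpl.
    pose proof (pow_le s k ltac:(lra)); pose proof (pow_le s (S k) ltac:(lra)) as Q; simpl in Q.
    assert (s ^ k <= 1) by (rewrite <- (pow1 k); apply pow_incr; lra).
    assert (s * ((1 - s) * (INR k * s ^ k)) <= s * (1 - s ^ k)) by (apply Rmult_le_compat_l; lra).
    assert (s * s ^ k <= 1) by nra.
    nra. }
  apply Rmult_le_reg_l with (1 - s); [lra|]; rewrite Rinv_r by lra.
  pose proof (pow_le s k ltac:(lra)); lra.
Qed.

(** Geometric decay that survives a factor [k^2], the size of the second-order remainder of [z^k].
    It comes from boundedness of the terms at a point closer to the unit circle. *)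
Lemma PS_coef_bound (a : nat -> Cx) (f : Cx -> Cx) (rho : R) :
  PS a f -> 0 <= rho < 1 ->
  exists M s, 0 < s < 1 /\ 0 <= M /\
    forall k, INR k ^ 2 * (Cnorm (a k) * rho ^ k) <= M * s ^ k.
Proof.
  intros H Hr.
  (* Here [1 - s = (1 - rho) / 4], so [rho <= s^4] by Bernoulli's inequality. Of the four factors
     [s^k], one bounds [a k], two absorb [k^2], and the last one gives the decay. *)
  set (s := (3 + rho) / 4); assert (Hs : 0 < s < 1) by (unfold s; lra).
  assert (Hrs : rho <= s ^ 4).
  { replace rho with (4 * s - 3) by (unfold s; lra).
    assert (0 <= (s - 1) ^ 2 * (s ^ 2 + 2 * s + 3)) by (apply Rmult_le_pos; nra).
    lra. }
  assert (Ns : inD (RtoC s)) by (unfold inD; rewrite Cnorm_RtoC, Rabs_pos_eq; lra).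
  destruct (has_sum_terms_bounded _ _ (H _ Ns)) as [M [HM B]].
  exists (M * / (1 - s) ^ 2), s; split; [auto|split].
  { apply Rmult_le_pos; [lra|]; apply Rlt_le, Rinv_0_lt_compat, pow_lt; lra. }
  intros k; specialize (B k).
  rewrite Cnorm_mul, Cnorm_pow, Cnorm_RtoC, Rabs_pos_eq in B by lra.
  pose proof (Cnorm_ge0 (a k)); pose proof (pos_INR k); pose proof (pow_le s k ltac:(lra)).
  assert (R1 : rho ^ k <= s ^ k * (s ^ k) ^ 3).
  { replace (s ^ k * (s ^ k) ^ 3) with ((s ^ 4) ^ k); [apply pow_incr; lra|].
    rewrite <- !pow_mult, <- pow_add; f_equal; lia. }
  assert (R2 : (INR k * s ^ k) ^ 2 <= / (1 - s) ^ 2).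
  { rewrite <- pow_inv by lra; apply pow_incr; split; [nra|now apply INR_pow_le]. }
  apply Rle_trans with (INR k ^ 2 * (Cnorm (a k) * (s ^ k * (s ^ k) ^ 3))).
  { apply Rmult_le_compat_l; [apply pow_le; lra|]; apply Rmult_le_compat_l; lra. }
  replace (INR k ^ 2 * (Cnorm (a k) * (s ^ k * (s ^ k) ^ 3)))
    with ((Cnorm (a k) * s ^ k) * (INR k * s ^ k) ^ 2 * s ^ k) by ring.
  apply Rmult_le_compat_r; auto; apply Rmult_le_compat; auto; [nra|apply pow_le; nra].
Qed.

(** The remainder [E] satisfies [E (k+1) = w E k + k z^(k-1) (w-z)^2], and [k^2 + k <= (k+1)^2]
    closes the induction. The factor [rho^2] on the left avoids the exponent [k - 2]; at [k = 0] the
    value of [pred] is harmless because its coefficient is 0. *)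
Lemma pow_second_order (z w : Cx) (rho : R) (k : nat) :
  Cnorm z <= rho -> Cnorm w <= rho ->
  Cnorm (Csub (Csub (Cpow w k) (Cpow z k))
              (Cmul (Cmul (RtoC (INR k)) (Cpow z (pred k))) (Csub w z))) * rho ^ 2
  <= INR k ^ 2 * rho ^ k * Cnorm (Csub w z) ^ 2.
Proof.
  intros Hz Hw; pose proof (Cnorm_ge0 z); pose proof (Cnorm_ge0 w).
  set (E := fun k => Csub (Csub (Cpow w k) (Cpow z k))
              (Cmul (Cmul (RtoC (INR k)) (Cpow z (pred k))) (Csub w z))).
  change (Cnorm (E k) * rho ^ 2 <= INR k ^ 2 * rho ^ k * Cnorm (Csub w z) ^ 2).
  set (D := Cnorm (Csub w z)).
  assert (Rec : forall k, E (S k) =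
    Cadd (Cmul w (E k)) (Cmul (Cmul (RtoC (INR k)) (Cpow z (pred k))) (Cmul (Csub w z) (Csub w z)))).
  { intros [|j]; unfold E; rewrite RtoC_S; simpl pred; simpl Cpow;
      [simpl INR; change (RtoC 0) with C0|]; ring. }
  induction k as [|k IH].
  - replace (E O) with C0 by (unfold E; simpl; change (RtoC 0) with C0; ring).
    rewrite Cnorm_C0; simpl; lra.
  - rewrite Rec, S_INR.
    eapply Rle_trans; [apply Rmult_le_compat_r; [nra|apply Cnorm_add]|].
    rewrite !Cnorm_mul, Cnorm_RtoC, Cnorm_pow, (Rabs_pos_eq (INR k)) by apply pos_INR.
    fold D; pose proof (Cnorm_ge0 (E k)); pose proof (pos_INR k).
    assert (0 <= D) by apply Cnorm_ge0.
    pose proof (pow_le rho k ltac:(lra)).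
    assert (T1 : Cnorm w * Cnorm (E k) * rho ^ 2 <= rho * (INR k ^ 2 * rho ^ k * D ^ 2)).
    { rewrite Rmult_assoc; apply Rmult_le_compat; auto; nra. }
    assert (T2 : INR k * Cnorm z ^ pred k * (D * D) * rho ^ 2 <= INR k * (rho * rho ^ k) * D ^ 2).
    { destruct k as [|j]; [simpl; nra|].
      simpl pred.
      assert (Cnorm z ^ j <= rho ^ j) by (apply pow_incr; lra).
      replace (INR (S j) * (rho * rho ^ S j) * D ^ 2) with (INR (S j) * rho ^ j * (D * D) * rho ^ 2)
        by (simpl; ring).
      apply Rmult_le_compat_r; [nra|]; apply Rmult_le_compat_r; [nra|].
      apply Rmult_le_compat_l; auto. }
    simpl (rho ^ S k).
    assert (0 <= rho * rho ^ k * D ^ 2) by (apply Rmult_le_pos; [nra|apply pow_le; auto]).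
    nra.
Qed.

Definition derive_coef (a : nat -> Cx) (k : nat) : Cx := Cmul (RtoC (INR (S k))) (a (S k)).

(** Termwise differentiation: summing the second-order remainders of the monomials bounds that of
    [f] by [K |w - z|^2] near [z]. *)
Lemma PS_deriv (a : nat -> Cx) (f : Cx -> Cx) :
  PS a f -> exists f1, PS (derive_coef a) f1 /\ forall z, inD z -> Cderiv_at f z (f1 z).
Proof.
  intros H.
  set (f1 := fun z => Cseries (fun k => Cmul (derive_coef a k) (Cpow z k))).
  assert (H1 : PS (derive_coef a) f1).
  { intros z Hz; unfold inD in Hz; pose proof (Cnorm_ge0 z).
    set (rho := (1 + Cnorm z) / 2).
    destruct (PS_coef_bound a f rho H) as [M [s [Hs [HM B]]]]; [unfold rho; lra|].
    apply has_sum_geom_bound with (M := M * s / rho) (s := s); auto; intros k.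
    unfold derive_coef; rewrite !Cnorm_mul, Cnorm_RtoC, Cnorm_pow, Rabs_pos_eq by apply pos_INR.
    specialize (B (S k)).
    assert (Hk : 1 <= INR (S k)) by (rewrite S_INR; pose proof (pos_INR k); lra).
    pose proof (Cnorm_ge0 (a (S k))).
    assert (Hrho : 0 < rho) by (unfold rho; lra).
    assert (Cnorm z ^ k <= rho ^ k) by (apply pow_incr; unfold rho; lra).
    assert (P : 0 <= rho ^ k) by (apply pow_le; lra).
    apply Rmult_le_reg_r with rho; auto.
    replace (M * s / rho * s ^ k * rho) with (M * s ^ S k) by (simpl; field; lra).
    eapply Rle_trans; [|exact B].
    replace (INR (S k) ^ 2 * (Cnorm (a (S k)) * rho ^ S k))
      with (INR (S k) * (INR (S k) * Cnorm (a (S k))) * rho ^ k * rho) by (simpl; ring).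
    apply Rmult_le_compat_r; [lra|].
    assert (0 <= INR (S k) * Cnorm (a (S k))) by nra.
    apply Rmult_le_compat; auto; [apply pow_le; auto|].
    nra. }
  exists f1; split; auto.
  intros z Hz; pose proof (Cnorm_ge0 z); assert (Nz := Hz); unfold inD in Nz.
  set (rho := (1 + Cnorm z) / 2); assert (Hrho : 0 < rho < 1) by (unfold rho; lra).
  destruct (PS_coef_bound a f rho H) as [M [s [Hs [HM B]]]]; [lra|].
  (* The sum of the geometric majorant [M s^k / rho^2] of the remainders. *)
  set (K := M / rho ^ 2 / (1 - s)).
  assert (Hrho2 : 0 < rho ^ 2) by (apply pow_lt; lra).
  assert (HK : 0 <= K) by (unfold K; apply Rdiv_le_0_compat; [apply Rdiv_le_0_compat; lra|lra]).
  assert (Q : forall w, Cnorm (Csub w z) < rho - Cnorm z ->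
    Cnorm (Csub (Csub (f w) (f z)) (Cmul (f1 z) (Csub w z))) <= K * Cnorm (Csub w z) ^ 2).
  { intros w Hw; set (D := Cnorm (Csub w z)) in *.
    assert (0 <= D) by apply Cnorm_ge0.
    assert (Nw : Cnorm w <= rho).
    { replace w with (Cadd (Csub w z) z) by ring; pose proof (Cnorm_add (Csub w z) z); fold D in H3; lra. }
    assert (Hw' : inD w) by (unfold inD; lra).
    (* The derived series is reindexed with a zero term at [k = 0], so that it lines up with the
       series of [f w] and [f z]. *)
    assert (S1 : has_sum (fun k => Cmul (Cmul (RtoC (INR k)) (a k)) (Cpow z (pred k))) (f1 z)).
    { replace (f1 z) with (Cadd (Cmul (Cmul (RtoC (INR 0)) (a O)) (Cpow z (pred 0))) (f1 z))
        by (simpl; change (RtoC 0) with C0; ring).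
      apply (has_sum_unshift (fun k => Cmul (Cmul (RtoC (INR k)) (a k)) (Cpow z (pred k)))).
      apply (H1 z Hz). }
    set (u := fun k => Cmul (a k) (Csub (Csub (Cpow w k) (Cpow z k))
              (Cmul (Cmul (RtoC (INR k)) (Cpow z (pred k))) (Csub w z)))).
    apply has_sum_norm_le with u.
    - pose proof (has_sum_add _ _ _ _ (H w Hw')
        (has_sum_add _ _ _ _ (has_sum_scal (Copp C1) _ _ (H z Hz))
           (has_sum_scal (Copp (Csub w z)) _ _ S1))) as S2.
      replace (Csub (Csub (f w) (f z)) (Cmul (f1 z) (Csub w z))) with
        (Cadd (f w) (Cadd (Cmul (Copp C1) (f z)) (Cmul (Copp (Csub w z)) (f1 z)))) by ring.
      eapply has_sum_ext, S2; intros k; unfold u; simpl; ring.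
    - intros N; replace (K * D ^ 2) with ((M / rho ^ 2 * D ^ 2) / (1 - s)) by (unfold K; field; lra).
      apply Csum_geom_bound; auto.
      + apply Rmult_le_pos; [apply Rdiv_le_0_compat; lra|nra].
      + intros k; unfold u; rewrite Cnorm_mul.
        pose proof (pow_second_order z w rho k ltac:(unfold rho; lra) Nw) as P; fold D in P.
        apply Rmult_le_reg_r with (rho ^ 2); auto.
        replace (M / rho ^ 2 * D ^ 2 * s ^ k * rho ^ 2) with (M * s ^ k * D ^ 2) by (field; lra).
        rewrite Rmult_assoc; eapply Rle_trans; [apply Rmult_le_compat_l; [apply Cnorm_ge0|exact P]|].
        replace (Cnorm (a k) * (INR k ^ 2 * rho ^ k * D ^ 2))
          with (INR k ^ 2 * (Cnorm (a k) * rho ^ k) * D ^ 2) by ring.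
        apply Rmult_le_compat_r; [nra|apply B]. }
  intros eps He.
  (* [K + 1] rather than [K], which may be 0. *)
  exists (Rmin (rho - Cnorm z) (eps / (K + 1))); split.
  { apply Rmin_glb_lt; [unfold rho; lra|apply Rdiv_lt_0_compat; lra]. }
  intros w [N0 Nw].
  pose proof (Rmin_l (rho - Cnorm z) (eps / (K + 1))); pose proof (Rmin_r (rho - Cnorm z) (eps / (K + 1))).
  specialize (Q w ltac:(lra)).
  assert (v0 : Csub w z <> C0) by now apply Cnorm_neq0.
  set (v := Csub w z) in *.
  replace (Csub (Cdiv (Csub (f w) (f z)) v) (f1 z))
    with (Cdiv (Csub (Csub (f w) (f z)) (Cmul (f1 z) v)) v) by (field; auto).
  rewrite Cnorm_div by auto.
  assert (L : Cnorm v * (K + 1) < eps).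
  { apply Rmult_lt_reg_r with (/ (K + 1)); [apply Rinv_0_lt_compat; lra|].
    rewrite Rmult_assoc, Rinv_r by lra; unfold Rdiv in *; lra. }
  apply Rmult_lt_reg_r with (Cnorm v); auto.
  replace (Cnorm (Csub (Csub (f w) (f z)) (Cmul (f1 z) v)) / Cnorm v * Cnorm v)
    with (Cnorm (Csub (Csub (f w) (f z)) (Cmul (f1 z) v))) by (field; lra).
  nra.
Qed.

Lemma PS_deriv_of (a : nat -> Cx) (f f1 : Cx -> Cx) :
  PS a f -> (forall z, inD z -> Cderiv_at f z (f1 z)) -> PS (derive_coef a) f1.
Proof.
  intros H D; destruct (PS_deriv a f H) as [g [Hg Dg]].
  apply PS_ext with (3 := Hg); auto; intros z Hz; eapply Cderiv_at_unique; eauto.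
Qed.

Lemma PS_hol_C1 (a : nat -> Cx) (f : Cx -> Cx) : PS a f -> hol_C1 f.
Proof.
  intros H; destruct (PS_deriv a f H) as [g [Hg Dg]]; destruct (PS_deriv _ _ Hg) as [k [_ Dk]].
  eapply hol_C1_deriv2; eauto.
Qed.

(** Coefficient [k + 1] of a series is, up to a nonzero factor, coefficient [k] of its derivative,
    which vanishes too; hence the induction over all [a]. *)
Lemma PS_zero (k : nat) : forall a : nat -> Cx, PS a (fun _ => C0) -> a k = C0.
Proof.
  induction k as [|k IH]; intros a H.
  - now rewrite <- (PS_C0 a _ H).
  - assert (E : derive_coef a k = C0).
    { apply IH, (PS_deriv_of a (fun _ => C0)); auto; intros; apply Cderiv_at_const. }
    assert (N : RtoC (INR (S k)) <> C0) by (apply RtoC_neq0, not_0_INR; lia).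
    unfold derive_coef in E.
    replace (a (S k)) with (Cmul (Cinv (RtoC (INR (S k)))) (Cmul (RtoC (INR (S k))) (a (S k))))
      by (field; auto).
    rewrite E; ring.
Qed.

Lemma PS_unique (a b : nat -> Cx) (f : Cx -> Cx) : PS a f -> PS b f -> forall k, a k = b k.
Proof.
  intros Ha Hb k.
  assert (E : Cadd (a k) (Cmul (Copp C1) (b k)) = C0).
  { apply (PS_zero k (fun k => Cadd (a k) (Cmul (Copp C1) (b k)))).
    apply PS_ext with (3 := PS_add _ _ _ _ Ha (PS_scal (Copp C1) _ _ Hb)); auto.
    intros; ring. }
  replace (a k) with (Cadd (Cadd (a k) (Cmul (Copp C1) (b k))) (b k)) by ring; rewrite E; ring.
Qed.

(** * Coefficients of functions with positive real part *)

Lemma Cconj_add (z w : Cx) : Cconj (Cadd z w) = Cadd (Cconj z) (Cconj w).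
Proof. apply Cx_eq; simpl; ring. Qed.

Lemma Cconj_mul (z w : Cx) : Cconj (Cmul z w) = Cmul (Cconj z) (Cconj w).
Proof. apply Cx_eq; simpl; ring. Qed.

Lemma Cconj_RtoC (x : R) : Cconj (RtoC x) = RtoC x.
Proof. apply Cx_eq; simpl; ring. Qed.

Lemma CconjK (z : Cx) : Cconj (Cconj z) = z.
Proof. apply Cx_eq; simpl; ring. Qed.

Lemma Cconj_pow (z : Cx) (n : nat) : Cconj (Cpow z n) = Cpow (Cconj z) n.
Proof.
  induction n as [|n IH]; simpl; [apply Cconj_RtoC|now rewrite Cconj_mul, IH].
Qed.

Lemma hol_C1_pow (n : nat) : hol_C1 (fun z => Cpow z n).
Proof.
  induction n as [|n IH]; simpl; [apply hol_C1_const|].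
  apply hol_C1_mul; auto using hol_C1_id.
Qed.

(* Long division of the power series [U] by [V]: after [j] steps the quotient is
   [quot_coef 0 + ... + quot_coef (j-1) z^(j-1)] and the remainder is
   [z^j] times the series with coefficients [quot_rem j]. *)
Fixpoint quot_rem (U V : nat -> Cx) (j : nat) : nat -> Cx :=
  match j with
  | O => U
  | S i => fun k => Csub (quot_rem U V i (S k)) (Cmul (Cdiv (quot_rem U V i O) (V O)) (V (S k)))
  end.

Definition quot_coef (U V : nat -> Cx) (j : nat) : Cx := Cdiv (quot_rem U V j O) (V O).

Section Caratheodory.

Variables (U V : nat -> Cx) (u v : Cx -> Cx).
Hypotheses (HU : PS U u) (HV : PS V v).
Hypothesis v_neq0 : forall z, inD z -> v z <> C0.
Hypothesis re_pos : forall z, inD z -> 0 < re (Cdiv (u z) (v z)).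

Let p := quot_coef U V.

Lemma V0_neq0 : V O <> C0.
Proof. rewrite <- (PS_C0 V v HV); apply v_neq0, inD_C0. Qed.

Lemma quot_rem_step (j : nat) (q : Cx -> Cx) :
  PS (quot_rem U V j) q -> exists q', PS (quot_rem U V (S j)) q' /\
    forall z, inD z -> q z = Cadd (Cmul (p j) (v z)) (Cmul z (q' z)).
Proof.
  intros H.
  destruct (PS_shift _ _ (PS_add _ _ _ _ H (PS_scal (Copp (p j)) _ _ HV))) as [q' [Hq' E]].
  exists q'; split.
  - apply PS_ext with (3 := Hq'); auto; intros k; simpl; unfold p, quot_coef; ring.
  - intros z Hz; specialize (E z Hz); cbv beta in E.
    replace (Cadd (quot_rem U V j O) (Cmul (Copp (p j)) (V O))) with C0 in E
      by (unfold p, quot_coef; field; apply V0_neq0).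
    transitivity (Cadd (Cadd (q z) (Cmul (Copp (p j)) (v z))) (Cmul (p j) (v z))); [ring|].
    rewrite E; ring.
Qed.

(* On [|w| = r] one has [conj w = r^2 / w], so multiplying [u / v] by [(conj w)^m]
   turns the first [m] terms of its expansion into the conjugate of a polynomial. *)
Lemma quot_circle (r : R) (m : nat) : 0 < r < 1 ->
  exists T q, hol_C1 T /\ PS (quot_rem U V (S m)) q /\
    T C0 = Cmul (RtoC ((r ^ 2) ^ m)) (Cconj (p m)) /\
    forall w, Cnorm w = r ->
      Cmul (Cdiv (u w) (v w)) (Cpow (Cconj w) m) =
      Cadd (Cconj (T w)) (Cmul (RtoC ((r ^ 2) ^ m)) (Cmul w (Cdiv (q w) (v w)))).
Proof.
  intros Hr; induction m as [|m IH].
  - destruct (quot_rem_step O u HU) as [q [Hq E]].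
    exists (fun _ => Cconj (p O)), q; split; [apply hol_C1_const|]; split; auto; split.
    + simpl; change (RtoC 1) with C1; ring.
    + intros w Hw; assert (Dw : inD w) by (unfold inD; lra).
      rewrite CconjK, (E w Dw); simpl; change (RtoC 1) with C1; field; auto.
  - destruct IH as [T [q [HT [Hq [_ E]]]]].
    destruct (quot_rem_step (S m) q Hq) as [q' [Hq' E']].
    set (c := RtoC ((r ^ 2) ^ S m)).
    (* Horner's scheme: the extra factor [conj w] turns [conj (T w)] into [conj (w T w)] and, by
       [w conj w = r^2], frees the term [p (S m)] of the next division step from its power of
       [w]. *)
    exists (fun z => Cadd (Cmul z (T z)) (Cmul c (Cconj (p (S m))))), q'.
    split; [apply hol_C1_add; [apply hol_C1_mul; auto using hol_C1_id|apply hol_C1_const]|].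
    split; auto; split; [ring|].
    intros w Hw; assert (Dw : inD w) by (unfold inD; lra).
    rewrite Cconj_add, !Cconj_mul, CconjK; unfold c; rewrite Cconj_RtoC.
    transitivity (Cmul (Cmul (Cdiv (u w) (v w)) (Cpow (Cconj w) m)) (Cconj w)); [simpl; ring|].
    rewrite (E w Hw), (E' w Dw).
    assert (X : RtoC ((r ^ 2) ^ S m) = Cmul (RtoC ((r ^ 2) ^ m)) (Cmul w (Cconj w))).
    { rewrite Cmul_conj, Hw, <- RtoC_mul; f_equal; simpl; ring. }
    rewrite X; field; auto.
Qed.

(** The free unimodular [kappa] lets the caller rotate [p (S m)] into the worst direction. *)
Lemma caratheodory_radius (r : R) (m : nat) (kappa : Cx) :
  0 < r < 1 -> Cnorm kappa = 1 ->
  0 <= 2 * re (p 0) + r ^ S m * re (Cmul kappa (Cconj (p (S m)))).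
Proof.
  intros Hr Hk.
  destruct (quot_circle r (S m) Hr) as [T [q [HT [Hq [T0 E]]]]].
  set (n := S m) in *.
  assert (Hrn : 0 < r ^ n) by (apply pow_lt; lra).
  assert (holP : forall f F, PS F f -> hol_C1 (fun z => Cdiv (f z) (v z))).
  { intros f F Hf; apply hol_C1_mul; [eapply PS_hol_C1; eauto|].
    apply hol_C1_inv; auto; eapply PS_hol_C1; eauto. }
  (* On the circle the [q] term equals [conj kappa (P conj(w)^n - conj (T w))]. Adding [kappa T w]
     leaves the conjugate half of the weight times [P], and a purely imaginary number. *)
  set (G := fun z => Cadd (Cdiv (u z) (v z)) (Cmul (RtoC (/ (2 * r ^ n)))
    (Cadd (Cmul (Cmul kappa (Cpow z n)) (Cdiv (u z) (v z)))
      (Cadd (Cmul kappa (T z))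
        (Cmul (Cmul (RtoC ((r ^ 2) ^ n)) (Cconj kappa)) (Cmul z (Cdiv (q z) (v z)))))))).
  assert (HG : hol_C1 G).
  { unfold G; repeat (apply hol_C1_add || apply hol_C1_mul);
      eauto using hol_C1_const, hol_C1_pow, hol_C1_id, PS_hol_C1, hol_C1_inv. }
  assert (G0 : 0 <= re (G C0)).
  { apply re_ge0_of_circle with r; auto; intros w Hw.
    assert (Dw : inD w) by (unfold inD; lra).
    set (P := Cdiv (u w) (v w)); set (xi := Cmul kappa (Cpow w n)).
    assert (Nxi : Cnorm xi = r ^ n) by (unfold xi; rewrite Cnorm_mul, Cnorm_pow, Hk, Hw; ring).
    assert (EG : G w = Cadd P (Cmul (RtoC (/ (2 * r ^ n)))
      (Cadd (Cmul P (Cadd xi (Cconj xi)))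
        (Csub (Cmul kappa (T w)) (Cconj (Cmul kappa (T w))))))).
    { unfold G; fold P xi; f_equal; f_equal.
      specialize (E w Hw); fold P in E.
      replace (Cmul (Cmul (RtoC ((r ^ 2) ^ n)) (Cconj kappa)) (Cmul w (Cdiv (q w) (v w))))
        with (Cmul (Cconj kappa) (Csub (Cmul P (Cpow (Cconj w) n)) (Cconj (T w)))) by (rewrite E; ring).
      unfold xi; rewrite !Cconj_mul, Cconj_pow; ring. }
    (* [xi + conj xi] is real and [kappa T w] minus its conjugate is imaginary, so only [re P] times
       the weight remains. *)
    assert (ReG : re (G w) = re P * (1 + re xi / r ^ n)).
    { rewrite EG; clearbody P xi; clear - Hrn; clearbody n; simpl; field; lra. }
    rewrite ReG; apply Rmult_le_pos; [apply Rlt_le, re_pos; auto|].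
    pose proof (Rabs_re_le xi) as B; rewrite Nxi in B; apply Rabs_le_between in B.
    apply Rmult_le_reg_r with (r ^ n); auto.
    replace ((1 + re xi / r ^ n) * r ^ n) with (r ^ n + re xi) by (field; lra); lra. }
  (* At 0 the terms carrying a factor [z] vanish; [T C0] contributes [r^(2n)], which over [2 r^n]
     leaves [r^n / 2]. *)
  assert (ReG0 : re (G C0) = re (p 0) + r ^ n / 2 * re (Cmul kappa (Cconj (p n)))).
  { replace (p 0%nat) with (Cdiv (u C0) (v C0))
      by (unfold p, quot_coef; simpl; now rewrite (PS_C0 U u HU), (PS_C0 V v HV)).
    unfold G; rewrite T0.
    replace (Cpow C0 n) with C0 by (unfold n; simpl; ring).
    replace (Cadd (Cmul (Cmul kappa C0) (Cdiv (u C0) (v C0)))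
        (Cadd (Cmul kappa (Cmul (RtoC ((r ^ 2) ^ n)) (Cconj (p n))))
           (Cmul (Cmul (RtoC ((r ^ 2) ^ n)) (Cconj kappa)) (Cmul C0 (Cdiv (q C0) (v C0))))))
      with (Cmul (RtoC ((r ^ 2) ^ n)) (Cmul kappa (Cconj (p n)))) by ring.
    replace ((r ^ 2) ^ n) with (r ^ n * r ^ n) by (rewrite <- pow_mult, <- pow_add; f_equal; lia).
    generalize (Cdiv (u C0) (v C0)) (Cmul kappa (Cconj (p n))); intros x y.
    clear - Hrn; clearbody n; simpl; field; lra. }
  lra.
Qed.

Lemma caratheodory (m : nat) : Cnorm (p (S m)) <= 2 * re (p 0).
Proof.
  destruct (Req_dec (Cnorm (p (S m))) 0) as [E|n].
  - pose proof (re_pos C0 inD_C0) as H; rewrite E.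
    replace (p 0%nat) with (Cdiv (u C0) (v C0)); [lra|].
    unfold p, quot_coef; simpl; now rewrite (PS_C0 U u HU), (PS_C0 V v HV).
  - set (x := p (S m)) in *; set (N := Cnorm x) in *.
    assert (HN : 0 < N) by (pose proof (Cnorm_ge0 x); fold N in H; lra).
    (* Chosen so that [kappa conj x = -|x|]. *)
    set (kappa := Cmul (RtoC (- / N)) x).
    assert (Hk : Cnorm kappa = 1).
    { unfold kappa; rewrite Cnorm_mul, Cnorm_RtoC, Rabs_Ropp, Rabs_pos_eq
        by (apply Rlt_le, Rinv_0_lt_compat; auto).
      fold N; field; lra. }
    assert (B : forall r, 0 < r < 1 -> r ^ S m * N <= 2 * re (p 0)).
    { intros r Hr; pose proof (caratheodory_radius r m kappa Hr Hk) as B; fold x in B.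
      replace (Cmul kappa (Cconj x)) with (RtoC (- N)) in B.
      - change (re (RtoC (- N))) with (- N) in B; lra.
      - unfold kappa; transitivity (Cmul (RtoC (- / N)) (Cmul x (Cconj x))); [|ring].
        rewrite Cmul_conj; fold N; rewrite <- RtoC_mul; f_equal; field; lra. }
    apply Rnot_lt_le; intros L.
    (* If [2 re (p 0) < N], continuity at 1 yields some [r < 1] with [r^(m+1) N > 2 re (p 0)],
       against [B]. The minimum with [1/2] keeps [r] positive. *)
    assert (Cont : continuity_pt (fun r => r ^ S m * N) 1) by (apply derivable_continuous_pt; reg).
    destruct (Cont (N - 2 * re (p 0)) ltac:(lra)) as [d [Hd Hc]].
    set (r := 1 - Rmin (d / 2) (/ 2)).
    pose proof (Rmin_l (d / 2) (/ 2)); pose proof (Rmin_r (d / 2) (/ 2)).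
    assert (0 < Rmin (d / 2) (/ 2)) by (apply Rmin_glb_lt; lra).
    specialize (Hc r); simpl in Hc; unfold Rdist in Hc.
    specialize (B r ltac:(unfold r; lra)).
    assert (Hr : Rabs (r - 1) < d) by (apply Rabs_def1; unfold r; lra).
    specialize (Hc (conj (conj I (Rgt_not_eq 1 r ltac:(unfold r; lra))) Hr)).
    rewrite pow1 in Hc; apply Rabs_def2 in Hc; simpl in B; lra.
Qed.

(** Unrolling the division, [quot_rem (j+1) k] is the sum over [i <= k] of [p (j+1+k-i) V i], and
    each such [p] has modulus at most 2. Lowering [k] by one costs one more division step, so [j]
    must vary in the induction. *)
Lemma quot_rem_bound (k : nat) : forall j, re (p 0) = 1 ->
  Cnorm (quot_rem U V (S j) k) <= 2 * sum_f_R0 (fun i => Cnorm (V i)) k.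
Proof.
  induction k as [|k IH]; intros j p0.
  - replace (quot_rem U V (S j) O) with (Cmul (p (S j)) (V O))
      by (unfold p, quot_coef; field; apply V0_neq0).
    rewrite Cnorm_mul; pose proof (caratheodory j); rewrite p0 in H.
    apply Rmult_le_compat_r; [apply Cnorm_ge0|lra].
  - replace (quot_rem U V (S j) (S k))
      with (Cadd (quot_rem U V (S (S j)) k) (Cmul (p (S j)) (V (S k))))
      by (simpl; unfold p, quot_coef; simpl; ring).
    eapply Rle_trans; [apply Cnorm_add|]; rewrite Cnorm_mul, tech5.
    pose proof (caratheodory j); rewrite p0 in H.
    assert (Cnorm (p (S j)) * Cnorm (V (S k)) <= 2 * Cnorm (V (S k)))
      by (apply Rmult_le_compat_r; [apply Cnorm_ge0|lra]).
    pose proof (IH (S j) p0); lra.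
Qed.

End Caratheodory.

(** * Coefficient bounds *)

Lemma A_1 (alpha : R) : A 1 alpha = 1.
Proof. unfold A; simpl; field. Qed.

Lemma A_SS (alpha : R) (n : nat) :
  INR (S (S n)) * A (S (S n)) alpha = A (S n) alpha * (INR (S (S n)) - 2 * alpha).
Proof.
  unfold A; change (prodA (S (S n)) alpha) with (prodA (S n) alpha * (INR (S (S n)) - 2 * alpha)).
  rewrite (fact_simpl (S n)), mult_INR; field; split; [apply INR_fact_neq_0|apply not_0_INR; lia].
Qed.

(** With [c_k = (k+1) A_{k+1}], [A_SS] reads [(n+1) c_{n+1} = n c_n + 2 (1 - alpha) c_n], which
    extends the sum by one term. *)
Lemma A_sum (alpha : R) (n : nat) :
  INR (S n) * (INR (S (S n)) * A (S (S n)) alpha) =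
  2 * (1 - alpha) * sum_f_R0 (fun k => INR (S k) * A (S k) alpha) n.
Proof.
  induction n as [|n IH].
  - rewrite A_SS; simpl sum_f_R0; rewrite A_1; simpl; ring.
  - rewrite tech5, Rmult_plus_distr_l, <- IH, A_SS.
    rewrite (S_INR (S (S n))), (S_INR (S n)); ring.
Qed.

Lemma coef_bound (alpha : R) (h h1 h2 : Cx -> Cx) (a : nat -> Cx) :
  alpha < 1 -> h1 C0 = C1 ->
  (forall z, inD z -> Cderiv_at h z (h1 z) /\ Cderiv_at h1 z (h2 z) /\ h1 z <> C0 /\
     alpha < re (Cadd C1 (Cdiv (Cmul z (h2 z)) (h1 z)))) ->
  PS a h -> forall n, Cnorm (a (S n)) <= A (S n) alpha.
Proof.
  intros Ha H10 H Pa.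
  set (beta := 1 - alpha); assert (Hb : 0 < beta) by (unfold beta; lra).
  set (c := derive_coef a).
  assert (Pc : PS c h1) by (apply (PS_deriv_of a h); auto; intros z Hz; apply H, Hz).
  assert (Pc1 : PS (derive_coef c) h2) by (apply (PS_deriv_of c h1); auto; intros z Hz; apply H, Hz).
  assert (c0 : c O = C1) by now rewrite <- (PS_C0 c h1 Pc).
  set (V := fun k => Cmul (RtoC beta) (c k)); set (v := fun z => Cmul (RtoC beta) (h1 z)).
  set (u := fun z => Cadd (Cmul z (h2 z)) (v z)).
  set (U := fun k => Cadd (Cmul (RtoC (INR k)) (c k)) (V k)).
  assert (b0 : RtoC beta <> C0) by (apply RtoC_neq0; lra).
  assert (PV : PS V v) by now apply PS_scal.
  assert (PU : PS U u).
  { apply PS_add; auto; apply PS_ext with (3 := PS_mulX _ _ Pc1); auto.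
    intros [|k]; [simpl; change (RtoC 0) with C0; ring|reflexivity]. }
  assert (v0 : forall z, inD z -> v z <> C0) by (intros z Hz; apply Cmul_neq0; auto; apply H, Hz).
  assert (Hre : forall z, inD z -> 0 < re (Cdiv (u z) (v z))).
  { intros z Hz; destruct (H z Hz) as [_ [_ [N0 Hal]]].
    replace (Cdiv (u z) (v z))
      with (Cmul (RtoC (/ beta)) (Cadd (Cdiv (Cmul z (h2 z)) (h1 z)) (RtoC beta))).
    - set (y := Cdiv (Cmul z (h2 z)) (h1 z)) in *; simpl in Hal |- *.
      rewrite Rmult_0_l, Rminus_0_r; apply Rmult_lt_0_compat;
        [now apply Rinv_0_lt_compat|unfold beta; lra].
    - replace (RtoC (/ beta)) with (Cinv (RtoC beta)) by (apply Cx_eq; simpl; field; lra).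
      unfold u, v; field; auto. }
  assert (p0 : quot_coef U V 0 = C1).
  { unfold quot_coef, quot_rem, U, V; rewrite c0; simpl; change (RtoC 0) with C0; field; auto. }
  assert (B : forall n, INR (S n) * Cnorm (c (S n)) <= 2 * beta * sum_f_R0 (fun i => Cnorm (c i)) n).
  { intros n.
    pose proof (quot_rem_bound U V u v PU PV v0 Hre n O ltac:(now rewrite p0)) as Q.
    (* Since [p 0 = 1], the first division step merely subtracts [V]: this remainder coefficient is
       [U (n+1) - V (n+1)], the coefficient of [z^(n+1)] in [z h'']. *)
    replace (quot_rem U V 1 n) with (Cmul (RtoC (INR (S n))) (c (S n))) in Q.
    - rewrite Cnorm_mul, Cnorm_RtoC, Rabs_pos_eq in Q by apply pos_INR.
      rewrite (sum_eq _ (fun i => Cnorm (c i) * beta)) in Q.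
      + rewrite <- scal_sum in Q; lra.
      + intros i _; unfold V; rewrite Cnorm_mul, Cnorm_RtoC, Rabs_pos_eq by lra; ring.
    - simpl quot_rem; fold (quot_coef U V 0).
      change (Cdiv (U O) (V O)) with (quot_coef U V 0); rewrite p0.
      unfold U; ring. }
  assert (C : forall n, Cnorm (c n) <= INR (S n) * A (S n) alpha).
  { intros n; induction n as [n IH] using (well_founded_induction Nat.lt_wf_0); destruct n as [|n].
    - rewrite c0, Cnorm_C1, A_1; simpl; lra.
    - apply Rmult_le_reg_l with (INR (S n)); [apply lt_0_INR; lia|].
      rewrite A_sum; eapply Rle_trans; [apply B|]; fold beta.
      apply Rmult_le_compat_l; [lra|]; apply sum_Rle; intros k Hk; apply IH; lia. }
  intros n; specialize (C n); unfold c, derive_coef in C.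
  rewrite Cnorm_mul, Cnorm_RtoC, Rabs_pos_eq in C by apply pos_INR.
  apply Rmult_le_reg_l with (INR (S n)); [apply lt_0_INR; lia|exact C].
Qed.

(** An equality of moduli rather than a bound, so that it serves both the estimate of [b] and its
    sharpness. *)
Lemma in_F_coef_g (alpha : R) (h g : Cx -> Cx) (a b : nat -> Cx) :
  in_F alpha h g -> PS a h -> PS b g ->
  forall n, Cnorm (b (S (S n))) = INR (S n) / INR (S (S n)) * Cnorm (a (S n)).
Proof.
  intros [h1 [h2 [g1 [theta [_ [_ [_ H]]]]]]] Pa Pb n.
  assert (Pc : PS (derive_coef a) h1) by (apply (PS_deriv_of a h); auto; intros z Hz; apply H, Hz).
  assert (Pd : PS (derive_coef b) g1) by (apply (PS_deriv_of b g); auto; intros z Hz; apply H, Hz).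
  pose proof (PS_scal (Cexpi theta) _ _ (PS_mulX _ _ Pc)) as Pe.
  assert (Pe' : PS (derive_coef b) (fun z => Cmul (Cexpi theta) (Cmul z (h1 z)))).
  { apply PS_ext with (3 := Pd); auto; intros z Hz; apply H, Hz. }
  pose proof (PS_unique _ _ _ Pe' Pe (S n)) as E; simpl in E; unfold derive_coef in E.
  apply (f_equal Cnorm) in E.
  rewrite !Cnorm_mul, Cnorm_Cexpi, !Cnorm_RtoC, !Rabs_pos_eq in E by apply pos_INR.
  assert (INR (S (S n)) <> 0) by (apply not_0_INR; lia).
  apply Rmult_eq_reg_l with (INR (S (S n))); auto.
  rewrite E; field; auto.
Qed.

(** Rewrites the stated bound on [b_n] as [(n-1)/n] times the bound on [a_{n-1}]; [alpha < 1] keeps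
    the denominator [n - 2 alpha] positive for [n >= 2]. *)
Lemma A_g (alpha : R) (n : nat) : alpha < 1 ->
  (INR (S (S n)) - 1) / (INR (S (S n)) - 2 * alpha) * A (S (S n)) alpha =
  INR (S n) / INR (S (S n)) * A (S n) alpha.
Proof.
  intros Ha; pose proof (A_SS alpha n) as E; pose proof (pos_INR n).
  assert (0 < INR (S (S n)) - 2 * alpha) by (rewrite !S_INR; lra).
  assert (0 < INR (S (S n))) by (apply lt_0_INR; lia).
  replace (INR (S (S n)) - 1) with (INR (S n)) by (rewrite !S_INR; ring).
  apply Rmult_eq_reg_l with (INR (S (S n))); [|lra].
  transitivity (INR (S n) / (INR (S (S n)) - 2 * alpha) * (INR (S (S n)) * A (S (S n)) alpha));
    [ring|rewrite E; field; lra].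
Qed.

(** * Exponential and logarithm *)

Lemma Cexp_add (z w : Cx) : Cexp (Cadd z w) = Cmul (Cexp z) (Cexp w).
Proof.
  apply Cx_eq; simpl; rewrite exp_plus, ?cos_plus, ?sin_plus; ring.
Qed.

Lemma Cexp_0 : Cexp C0 = C1.
Proof. apply Cx_eq; simpl; rewrite exp_0, ?cos_0, ?sin_0; ring. Qed.

Lemma Cexp_neq0 (z : Cx) : Cexp z <> C0.
Proof.
  intros E; assert (X : Cmul (Cexp z) (Cexp (Copp z)) = C1).
  { rewrite <- Cexp_add, <- Cexp_0; f_equal; ring. }
  rewrite E in X; apply (f_equal re) in X; simpl in X; lra.
Qed.

Lemma Cexpi_add (s t : R) : Cexpi (s + t) = Cmul (Cexpi s) (Cexpi t).
Proof. apply Cx_eq; simpl; rewrite ?cos_plus, ?sin_plus; ring. Qed.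

Lemma Cexpi_opp (t : R) : Cmul (Cexpi (- t)) (Cexpi t) = C1.
Proof.
  rewrite <- Cexpi_add, Rplus_opp_l; apply Cx_eq; simpl; [apply cos_0|apply sin_0].
Qed.

Lemma Cderiv_at_Cexp (z : Cx) : Cderiv_at Cexp z (Cexp z).
Proof.
  apply Cderiv_at_segments with 1; [lra| |].
  - assert (Ce : continuous (fun w : Cx => exp (re w)) z)
      by (apply (continuous_comp re exp); [apply continuous_re|apply continuous_exp]).
    assert (Cc : continuous (fun w : Cx => cos (im w)) z)
      by (apply (continuous_comp im cos); [apply continuous_im|apply continuous_cos]).
    assert (Cs : continuous (fun w : Cx => sin (im w)) z)
      by (apply (continuous_comp im sin); [apply continuous_im|apply continuous_sin]).
    apply continuous_mkC; now apply continuous_Rmult.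
  - intros w t _ _; generalize (Csub w z); intros v; simpl; split; unfold Rminus; auto_derive; auto; ring.
Qed.

Lemma ln_sqrt_half (x : R) : 0 < x -> ln (sqrt x) = / 2 * ln x.
Proof.
  intros H; pose proof (sqrt_lt_R0 x H) as P.
  rewrite <- (sqrt_sqrt x) at 2 by lra; rewrite ln_mult by auto; field.
Qed.

(** For [z] in the disc, [1 - z] lies in the right half-plane, so this branch of [Carg] is the only
    one that has to be differentiated. *)
Lemma Clog_right (z : Cx) : 0 < re z ->
  Clog z = mkC (/ 2 * ln (re z ^ 2 + im z ^ 2)) (atan (im z / re z)).
Proof.
  intros H; apply Cx_eq; simpl re; simpl im.
  - apply ln_sqrt_half; nra.
  - unfold Carg; destruct Rlt_dec; [reflexivity|contradiction].
Qed.

Lemma re_right_open (z w : Cx) : Cnorm (Csub w z) < re z -> 0 < re w.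
Proof.
  intros H; pose proof (Rabs_re_le (Csub w z)) as B; apply Rabs_le_between in B; simpl in B; lra.
Qed.

Lemma Cderiv_at_Clog (z : Cx) : 0 < re z -> Cderiv_at Clog z (Cinv z).
Proof.
  intros Hz.
  apply (Cderiv_at_ext_loc
    (fun w => mkC (/ 2 * ln (re w ^ 2 + im w ^ 2)) (atan (im w / re w))) _ _ _ (re z)); auto.
  { intros w Hw; symmetry; apply Clog_right; eapply re_right_open; eauto. }
  apply Cderiv_at_segments with (re z); auto.
  - apply (continuous_Cinv (fun w => w)); [|apply continuous_id_Cx].
    intros E; rewrite E in Hz; simpl in Hz; lra.
  - intros w t Hw Ht; set (v := Csub w z) in *.
    assert (Hx : 0 < re z + t * re v).
    { pose proof (Rabs_re_le v) as B; apply Rabs_le_between in B; nra. }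
    clearbody v; clear Hw.
    destruct z as [x y], v as [a b]; simpl in *.
    assert (X0 : 0 < x + (t * a + - (0 * b))) by lra.
    split; auto_derive; unfold Rminus; revert X0;
      generalize (x + (t * a + - (0 * b))) (y + (t * b + 0 * a)); intros X Y X0.
    + nra.
    + field; nra.
    + lra.
    + field; split; nra.
Qed.

Lemma Cexp_Clog (z : Cx) : 0 < re z -> Cexp (Clog z) = z.
Proof.
  intros Hz.
  assert (N0 : z <> C0) by (intros E; rewrite E in Hz; simpl in Hz; lra).
  pose proof (Cnorm_gt0 z N0) as Nz.
  assert (S : sqrt (1 + (im z / re z)²) = Cnorm z / re z).
  { apply sqrt_lem_1; [unfold Rsqr; nra|apply Rdiv_le_0_compat; lra|].
    replace (Cnorm z / re z * (Cnorm z / re z)) with (Cnorm z ^ 2 / re z ^ 2) by (field; lra).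
    rewrite Cnorm_sqr; unfold Rsqr; field; lra. }
  unfold Cexp, Clog; simpl re; simpl im; rewrite exp_ln by auto.
  unfold Carg; destruct Rlt_dec; [|contradiction].
  rewrite cos_atan, sin_atan, S; apply Cx_eq; simpl; field; lra.
Qed.

(** * The extremal functions *)

Lemma re_one_sub (z : Cx) : inD z -> 0 < re (Csub C1 z).
Proof.
  unfold inD; intros H; pose proof (Rabs_re_le z) as B; apply Rabs_le_between in B; simpl; lra.
Qed.

Lemma one_sub_neq0 (z : Cx) : inD z -> Csub C1 z <> C0.
Proof. intros H E; apply re_one_sub in H; rewrite E in H; simpl in H; lra. Qed.

Lemma Cderiv_at_one_sub (z : Cx) : Cderiv_at (fun w => Csub C1 w) z (Copp C1).
Proof.
  eapply Cderiv_at_eq; [apply Cderiv_at_sub; [apply Cderiv_at_const|apply Cderiv_at_id]|ring].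
Qed.

Lemma Cderiv_at_log_one_sub (z : Cx) : inD z ->
  Cderiv_at (fun w => Clog (Csub C1 w)) z (Copp (Cinv (Csub C1 z))).
Proof.
  intros H; eapply Cderiv_at_eq.
  - apply (Cderiv_at_comp Clog (fun w => Csub C1 w));
      [apply Cderiv_at_Clog, re_one_sub, H|apply Cderiv_at_one_sub].
  - ring.
Qed.

Lemma Cderiv_at_pow_one_sub (c : R) (z : Cx) : inD z ->
  Cderiv_at (fun w => Cpowc (Csub C1 w) (RtoC c)) z
    (Copp (Cdiv (Cmul (RtoC c) (Cpowc (Csub C1 z) (RtoC c))) (Csub C1 z))).
Proof.
  intros H; eapply Cderiv_at_eq.
  - apply (Cderiv_at_comp Cexp (fun w => Cmul (RtoC c) (Clog (Csub C1 w)))).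
    + apply Cderiv_at_Cexp.
    + apply (Cderiv_at_scal (RtoC c) (fun w => Clog (Csub C1 w))).
      now apply Cderiv_at_log_one_sub.
  - unfold Cpowc; field; now apply one_sub_neq0.
Qed.

Lemma pow_one_sub_S (c : R) (z : Cx) : inD z ->
  Cpowc (Csub C1 z) (RtoC (c + 1)) = Cmul (Cpowc (Csub C1 z) (RtoC c)) (Csub C1 z).
Proof.
  intros H; unfold Cpowc; rewrite RtoC_add; change (RtoC 1) with C1.
  rewrite <- (Cexp_Clog (Csub C1 z)) at 3 by now apply re_one_sub.
  rewrite <- Cexp_add; f_equal; ring.
Qed.

Lemma pow_one_sub_0 (z : Cx) : Cpowc (Csub C1 z) (RtoC 0) = C1.
Proof. unfold Cpowc; rewrite <- Cexp_0; f_equal; change (RtoC 0) with C0; ring. Qed.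

Lemma pow_one_sub_m1 (z : Cx) : inD z -> Cpowc (Csub C1 z) (RtoC (-1)) = Cinv (Csub C1 z).
Proof.
  intros H; pose proof (one_sub_neq0 z H).
  pose proof (pow_one_sub_S (-1) z H) as E.
  replace (-1 + 1) with 0 in E by ring; rewrite pow_one_sub_0 in E.
  transitivity (Cdiv (Cmul (Cpowc (Csub C1 z) (RtoC (-1))) (Csub C1 z)) (Csub C1 z));
    [field; auto|rewrite <- E; field; auto].
Qed.

Lemma pow_one_sub_m2 (z : Cx) : inD z ->
  Cpowc (Csub C1 z) (RtoC (-2)) = Cinv (Cmul (Csub C1 z) (Csub C1 z)).
Proof.
  intros H; pose proof (one_sub_neq0 z H).
  pose proof (pow_one_sub_S (-2) z H) as E.
  replace (-2 + 1) with (-1) in E by ring; rewrite pow_one_sub_m1 in E by auto.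
  transitivity (Cdiv (Cmul (Cpowc (Csub C1 z) (RtoC (-2))) (Csub C1 z)) (Csub C1 z));
    [field; auto|rewrite <- E; field; auto].
Qed.

(** A single power is the derivative of [h_alpha] in all three cases; the separate formulas only
    reflect how it integrates. *)
Definition h1_alpha (alpha : R) (z : Cx) : Cx := Cpowc (Csub C1 z) (RtoC (2 * alpha - 2)).

Definition h2_alpha (alpha : R) (z : Cx) : Cx :=
  Cdiv (Cmul (RtoC (2 - 2 * alpha)) (h1_alpha alpha z)) (Csub C1 z).

Lemma Cderiv_at_h_alpha (alpha : R) (z : Cx) : inD z ->
  Cderiv_at (h_alpha alpha) z (h1_alpha alpha z).
Proof.
  intros Hz; pose proof (one_sub_neq0 z Hz) as N.
  unfold h_alpha, h1_alpha; destruct Req_EM_T as [->|n0]; [|destruct Req_EM_T as [->|n1]].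
  - eapply Cderiv_at_eq.
    + apply (Cderiv_at_div (fun w => w) (fun w => Csub C1 w)); auto;
        [apply Cderiv_at_id|apply Cderiv_at_one_sub].
    + replace (2 * 0 - 2) with (-2) by ring; rewrite pow_one_sub_m2 by auto; field; auto.
  - eapply Cderiv_at_eq; [apply (Cderiv_at_opp (fun w => Clog (Csub C1 w)));
      now apply Cderiv_at_log_one_sub|].
    replace (2 * (1 / 2) - 2) with (-1) by field; rewrite pow_one_sub_m1 by auto; ring.
  - assert (c0 : RtoC (2 * alpha - 1) <> C0) by (apply RtoC_neq0; lra).
    eapply Cderiv_at_eq.
    + apply (Cderiv_at_div (fun w => Csub C1 (Cpowc (Csub C1 w) (RtoC (2 * alpha - 1))))
        (fun _ => RtoC (2 * alpha - 1))); auto; [|apply Cderiv_at_const].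
      apply Cderiv_at_sub; [apply Cderiv_at_const|now apply Cderiv_at_pow_one_sub].
    + replace (Cpowc (Csub C1 z) (RtoC (2 * alpha - 1)))
        with (Cmul (Cpowc (Csub C1 z) (RtoC (2 * alpha - 2))) (Csub C1 z))
        by (rewrite <- pow_one_sub_S by auto; do 2 f_equal; ring).
      field; auto.
Qed.

Lemma Cderiv_at_h1_alpha (alpha : R) (z : Cx) : inD z ->
  Cderiv_at (h1_alpha alpha) z (h2_alpha alpha z).
Proof.
  intros Hz; eapply Cderiv_at_eq; [now apply Cderiv_at_pow_one_sub|].
  unfold h2_alpha, h1_alpha.
  replace (2 - 2 * alpha) with (0 - (2 * alpha - 2)) by ring.
  rewrite (RtoC_sub 0); change (RtoC 0) with C0; field; now apply one_sub_neq0.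
Qed.

Lemma Cderiv_at_g_alpha (alpha : R) (z : Cx) : inD z ->
  Cderiv_at (g_alpha alpha) z (Cmul z (h1_alpha alpha z)).
Proof.
  intros Hz; pose proof (one_sub_neq0 z Hz) as N.
  unfold g_alpha, h1_alpha; destruct Req_EM_T as [->|n0]; [|destruct Req_EM_T as [->|n1]].
  - eapply Cderiv_at_eq.
    + apply (Cderiv_at_add (fun w => Cdiv w (Csub C1 w)) (fun w => Clog (Csub C1 w)));
        [|now apply Cderiv_at_log_one_sub].
      apply (Cderiv_at_div (fun w => w) (fun w => Csub C1 w)); auto;
        [apply Cderiv_at_id|apply Cderiv_at_one_sub].
    + replace (2 * 0 - 2) with (-2) by ring; rewrite pow_one_sub_m2 by auto; field; auto.
  - eapply Cderiv_at_eq.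
    + apply (Cderiv_at_opp (fun w => Cadd w (Clog (Csub C1 w)))).
      apply Cderiv_at_add; [apply Cderiv_at_id|now apply Cderiv_at_log_one_sub].
    + replace (2 * (1 / 2) - 2) with (-1) by field; rewrite pow_one_sub_m1 by auto; field; auto.
  - set (c := 2 * alpha - 1).
    replace (2 * alpha) with (c + 1) by (unfold c; ring).
    assert (c0 : RtoC c <> C0) by (apply RtoC_neq0; unfold c; lra).
    assert (c1 : Cadd (RtoC c) C1 <> C0)
      by (change C1 with (RtoC 1); rewrite <- RtoC_add; apply RtoC_neq0; unfold c; lra).
    rewrite RtoC_mul, RtoC_add; change (RtoC 1) with C1.
    eapply Cderiv_at_eq.
    + apply (Cderiv_at_div (fun w => Csub C1 (Cmul (Cpowc (Csub C1 w) (RtoC c)) (Cadd C1 (Cmul w (RtoC c)))))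
        (fun _ => Cmul (Cadd (RtoC c) C1) (RtoC c))); [now apply Cmul_neq0| |apply Cderiv_at_const].
      apply Cderiv_at_sub; [apply Cderiv_at_const|].
      apply (Cderiv_at_mul (fun w => Cpowc (Csub C1 w) (RtoC c)) (fun w => Cadd C1 (Cmul w (RtoC c))));
        [now apply Cderiv_at_pow_one_sub|].
      apply Cderiv_at_add; [apply Cderiv_at_const|].
      apply (Cderiv_at_mul (fun w => w)); [apply Cderiv_at_id|apply Cderiv_at_const].
    + cbv beta.
      replace (Cpowc (Csub C1 z) (RtoC c))
        with (Cmul (Cpowc (Csub C1 z) (RtoC (c + 1 - 2))) (Csub C1 z))
        by (rewrite <- pow_one_sub_S by auto; do 2 f_equal; ring).
      field; auto.
Qed.

(** For [h_alpha], [1 + z h''/h' = 1 + (2 - 2 alpha) z / (1 - z)], and the bound [-1/2] makes its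
    real part exceed exactly [alpha]. *)
Lemma re_halfplane (z : Cx) : inD z -> - / 2 < re (Cdiv z (Csub C1 z)).
Proof.
  intros Hz; pose proof (Cnorm_sqr z) as S; pose proof (Cnorm_ge0 z); unfold inD in Hz.
  assert (L : re z ^ 2 + im z ^ 2 < 1) by (rewrite <- S; nra).
  destruct z as [x y]; simpl in *.
  set (D := (1 + - x) * ((1 + - x) * 1) + (0 + - y) * ((0 + - y) * 1)).
  assert (HD : 0 < D) by (unfold D; nra).
  apply Rmult_lt_reg_r with D; auto.
  replace ((x * ((1 + - x) / D) - y * (- (0 + - y) / D)) * D) with (x * (1 - x) - y * y) by (field; lra).
  unfold D; nra.
Qed.

Lemma Clog_1 : Clog C1 = C0.
Proof.
  rewrite Clog_right by (simpl; lra); apply Cx_eq; simpl.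
  - replace (1 * (1 * 1) + 0 * (0 * 1)) with 1 by ring; rewrite ln_1; ring.
  - unfold Rdiv; rewrite Rmult_0_l; apply atan_0.
Qed.

Lemma one_sub_C0 : Csub C1 C0 = C1.
Proof. ring. Qed.

Lemma Cpowc_C1 (c : Cx) : Cpowc C1 c = C1.
Proof. unfold Cpowc; rewrite Clog_1, <- Cexp_0; f_equal; ring. Qed.

Lemma h1_alpha_neq0 (alpha : R) (z : Cx) : h1_alpha alpha z <> C0.
Proof. apply Cexp_neq0. Qed.

Lemma in_F_alpha (alpha : R) : alpha < 1 -> in_F alpha (h_alpha alpha) (g_alpha alpha).
Proof.
  intros Ha.
  exists (h1_alpha alpha), (h2_alpha alpha), (fun z => Cmul z (h1_alpha alpha z)), 0.
  split; [|split; [|split]].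
  - unfold h_alpha; rewrite one_sub_C0, Clog_1, Cpowc_C1.
    destruct Req_EM_T; [|destruct Req_EM_T]; unfold Cdiv; ring.
  - unfold g_alpha; rewrite one_sub_C0, Clog_1, Cpowc_C1.
    destruct Req_EM_T; [|destruct Req_EM_T]; unfold Cdiv; ring.
  - unfold h1_alpha; rewrite one_sub_C0; apply Cpowc_C1.
  - intros z Hz; pose proof (h1_alpha_neq0 alpha z) as N.
    split; [now apply Cderiv_at_h_alpha|]; split; [now apply Cderiv_at_h1_alpha|].
    split; [now apply Cderiv_at_g_alpha|]; split; auto; split.
    + replace (Cdiv (Cmul z (h2_alpha alpha z)) (h1_alpha alpha z))
        with (Cmul (RtoC (2 - 2 * alpha)) (Cdiv z (Csub C1 z)))
        by (unfold h2_alpha; field; split; auto; now apply one_sub_neq0).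
      pose proof (re_halfplane z Hz) as B; set (y := Cdiv z (Csub C1 z)) in *.
      clearbody y; simpl; nra.
    + replace (Cexpi 0) with C1 by (apply Cx_eq; simpl; [rewrite cos_0|rewrite sin_0]; reflexivity).
      ring.
Qed.

(** * Rotations and the coefficients of the extremal functions *)

Lemma inD_rot (phi : R) (z : Cx) : inD z -> inD (Cmul (Cexpi phi) z).
Proof. unfold inD; now rewrite Cnorm_mul, Cnorm_Cexpi, Rmult_1_l. Qed.

Lemma Cderiv_at_comp_rot (phi : R) (f : Cx -> Cx) (z l : Cx) :
  Cderiv_at f (Cmul (Cexpi phi) z) l ->
  Cderiv_at (fun w => f (Cmul (Cexpi phi) w)) z (Cmul (Cexpi phi) l).
Proof.
  intros H; eapply Cderiv_at_eq.
  - apply (Cderiv_at_comp f (fun w => Cmul (Cexpi phi) w)); [exact H|].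
    apply (Cderiv_at_scal (Cexpi phi) (fun w => w)), Cderiv_at_id.
  - ring.
Qed.

Lemma Cderiv_at_hrot (phi : R) (h : Cx -> Cx) (z l : Cx) :
  Cderiv_at h (Cmul (Cexpi phi) z) l -> Cderiv_at (hrot phi h) z l.
Proof.
  intros H; eapply Cderiv_at_eq.
  - apply (Cderiv_at_scal (Cexpi (- phi)) (fun w => h (Cmul (Cexpi phi) w))).
    apply Cderiv_at_comp_rot, H.
  - transitivity (Cmul (Cmul (Cexpi (- phi)) (Cexpi phi)) l); [ring|rewrite Cexpi_opp; ring].
Qed.

(** The usual rotation [e^{-i phi} f(e^{i phi} z)] is the case [psi = phi], as the analytic factor
    under the conjugate is [e^{i phi}]. An independent [psi] also lets the constant of the
    dilatation vary freely. *)
Lemma in_F_rot (alpha phi psi : R) (h g : Cx -> Cx) :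
  in_F alpha h g -> in_F alpha (hrot phi h) (grot phi psi g).
Proof.
  intros [h1 [h2 [g1 [theta [h0 [g0 [h10 H]]]]]]].
  set (e := Cexpi phi).
  assert (e0 : Cmul e C0 = C0) by ring.
  (* One [phi] in the new constant comes from the chain rule for [g], the other from the factor [z]
     evaluated at [e z]. *)
  exists (fun z => h1 (Cmul e z)), (fun z => Cmul e (h2 (Cmul e z))),
    (fun z => Cmul (Cexpi psi) (Cmul e (g1 (Cmul e z)))), (psi + (theta + (phi + phi))).
  unfold hrot at 1, grot at 1; fold e; rewrite e0, h0, g0, h10.
  split; [ring|]; split; [ring|]; split; [reflexivity|].
  intros z Hz; destruct (H _ (inD_rot phi z Hz)) as [D1 [D2 [D3 [N [B E]]]]]; fold e in D1, D2, D3, N, B, E.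
  split; [now apply Cderiv_at_hrot|]; split; [now apply Cderiv_at_comp_rot|].
  split; [now apply (Cderiv_at_scal _ (fun w => g (Cmul (Cexpi phi) w))), Cderiv_at_comp_rot|].
  split; [exact N|]; split.
  - now replace (Cmul z (Cmul e (h2 (Cmul e z)))) with (Cmul (Cmul e z) (h2 (Cmul e z))) by ring.
  - rewrite E, !Cexpi_add; fold e; ring.
Qed.

(** With [e = e^{i phi}], the rotated equation [(1 - e z) h'' = (2 - 2 alpha) e h'] gives
    [(k+1) c_{k+1} = (k + 2 - 2 alpha) e c_k]. The factor [k + 2 - 2 alpha] is positive, so the
    moduli obey the recursion [A_SS] exactly. *)
Lemma coef_hrot (alpha phi : R) (a : nat -> Cx) :
  alpha < 1 -> PS a (hrot phi (h_alpha alpha)) ->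
  forall n, Cnorm (a (S n)) = A (S n) alpha.
Proof.
  intros Ha Pa; set (e := Cexpi phi).
  set (h1 := fun z => h1_alpha alpha (Cmul e z)); set (h2 := fun z => Cmul e (h2_alpha alpha (Cmul e z))).
  set (c := derive_coef a).
  assert (Pc : PS c h1).
  { apply (PS_deriv_of _ _ _ Pa); intros z Hz.
    apply Cderiv_at_hrot, Cderiv_at_h_alpha, inD_rot, Hz. }
  assert (Pc1 : PS (derive_coef c) h2).
  { apply (PS_deriv_of _ _ _ Pc); intros z Hz.
    apply (Cderiv_at_comp_rot phi), Cderiv_at_h1_alpha, inD_rot, Hz. }
  pose proof (PS_scal (Cmul (RtoC (2 - 2 * alpha)) e) _ _ Pc) as P2.
  pose proof (PS_add _ _ _ _ Pc1 (PS_scal (Copp e) _ _ (PS_mulX _ _ Pc1))) as P3.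
  assert (P4 : PS (fun k => Cadd (derive_coef c k)
                     (Cmul (Copp e) match k with O => C0 | S j => derive_coef c j end))
                  (fun z => Cmul (Cmul (RtoC (2 - 2 * alpha)) e) (h1 z))).
  { apply PS_ext with (3 := P3); [reflexivity|].
    intros z Hz; unfold h2, h2_alpha; fold (h1 z); field.
    apply one_sub_neq0, inD_rot, Hz. }
  assert (Rec : forall k, Cmul (RtoC (INR (S k))) (c (S k)) =
      Cmul (Cmul (RtoC (INR (S (S k)) - 2 * alpha)) e) (c k)).
  { intros k; pose proof (PS_unique _ _ _ P4 P2 k) as E; cbv beta in E.
    assert (E2 : derive_coef c k = Cadd (Cmul (Cmul (RtoC (2 - 2 * alpha)) e) (c k))
      (Cmul e (Cmul (RtoC (INR k)) (c k)))).
    { rewrite <- E; destruct k as [|k]; [simpl; change (RtoC 0) with C0; ring|].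
      change (derive_coef c k) with (Cmul (RtoC (INR (S k))) (c (S k))); ring. }
    change (Cmul (RtoC (INR (S k))) (c (S k))) with (derive_coef c k); rewrite E2.
    replace (INR (S (S k)) - 2 * alpha) with ((2 - 2 * alpha) + INR k) by (rewrite !S_INR; ring).
    rewrite RtoC_add; ring. }
  assert (c0 : c O = C1).
  { rewrite <- (PS_C0 c h1 Pc); unfold h1, h1_alpha.
    replace (Csub C1 (Cmul e C0)) with C1 by ring; apply Cpowc_C1. }
  assert (C : forall n, Cnorm (c n) = INR (S n) * A (S n) alpha).
  { induction n as [|n IH].
    - rewrite c0, Cnorm_C1, A_1; simpl; ring.
    - pose proof (Rec n) as E; apply (f_equal Cnorm) in E.
      assert (0 < INR (S (S n)) - 2 * alpha) by (rewrite !S_INR; pose proof (pos_INR n); lra).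
      rewrite !Cnorm_mul, !Cnorm_RtoC, (Rabs_pos_eq (INR (S n))), IH in E by apply pos_INR.
      rewrite (Rabs_pos_eq (INR (S (S n)) - 2 * alpha)) in E by lra.
      unfold e in E; rewrite Cnorm_Cexpi in E.
      apply Rmult_eq_reg_l with (INR (S n)); [|apply not_0_INR; lia].
      rewrite E, A_SS; ring. }
  intros n; specialize (C n); unfold c, derive_coef in C.
  rewrite Cnorm_mul, Cnorm_RtoC, Rabs_pos_eq in C by apply pos_INR.
  apply Rmult_eq_reg_l with (INR (S n)); [exact C|apply not_0_INR; lia].
Qed.

Theorem theorem2 (alpha : R) (Ha : 0 <= alpha < 1) :
  (forall (h g : Cx -> Cx) (a b : nat -> Cx),
     in_F alpha h g ->
     (forall z, inD z -> has_sum (fun k => Cmul (a k) (Cpow z k)) (h z)) ->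
     (forall z, inD z -> has_sum (fun k => Cmul (b k) (Cpow z k)) (g z)) ->
     forall n : nat, (2 <= n)%nat ->
       Cnorm (a n) <= A n alpha /\
       Cnorm (b n) <= (INR n - 1) / (INR n - 2 * alpha) * A n alpha)
  /\
  (forall phi psi : R,
     in_F alpha (hrot phi (h_alpha alpha)) (grot phi psi (g_alpha alpha)) /\
     forall a b : nat -> Cx,
       (forall z, inD z ->
          has_sum (fun k => Cmul (a k) (Cpow z k)) (hrot phi (h_alpha alpha) z)) ->
       (forall z, inD z ->
          has_sum (fun k => Cmul (b k) (Cpow z k)) (grot phi psi (g_alpha alpha) z)) ->
       forall n : nat, (2 <= n)%nat ->
         Cnorm (a n) = A n alpha /\
         Cnorm (b n) = (INR n - 1) / (INR n - 2 * alpha) * A n alpha).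
Proof.
  split.
  - intros h g a b HF Pa Pb [|[|n]] Hn; [lia|lia|].
    (* Index 1 is included because the bound on [b 2] rests on [a 1]. *)
    assert (B : forall m, Cnorm (a (S m)) <= A (S m) alpha).
    { destruct HF as [h1 [h2 [g1 [theta [_ [_ [h10 H]]]]]]].
      apply (coef_bound alpha h h1 h2); auto; [lra|].
      intros z Hz; destruct (H z Hz) as [D1 [D2 [_ [N [Re _]]]]]; auto. }
    split; [apply B|].
    rewrite A_g, (in_F_coef_g alpha h g a b HF Pa Pb) by lra.
    apply Rmult_le_compat_l; [|apply B].
    apply Rdiv_le_0_compat; [apply pos_INR|apply lt_0_INR; lia].
  - intros phi psi.
    assert (HF : in_F alpha (hrot phi (h_alpha alpha)) (grot phi psi (g_alpha alpha)))
      by (apply in_F_rot, in_F_alpha; lra).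
    split; auto; intros a b Pa Pb [|[|n]] Hn; [lia|lia|].
    assert (B := coef_hrot alpha phi a ltac:(lra) Pa).
    split; [apply B|].
    now rewrite A_g, (in_F_coef_g alpha _ _ a b HF Pa Pb), B by lra.
Qed.
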